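(* In event-triggered control with perfect information, the policy profile $(\pi^*,\mu^* )$ given by $$\delta_k^*=\mathbf{1}_{\{\mathrm{VoI}_k\ge 0\}},\qquad \mathrm{VoI}_k=e_k^TA_k^T\Gamma_{k+1}A_ke_k-\theta_k+\varrho_k,$$ and $$u_k^*=-L_k\hat x_k,\qquad L_k=(B_k^TS_{k+1}B_k+R_k)^{-1}B_k^TS_{k+1}A_k,$$ is a Nash equilibrium of the problem of minimizing $\Psi(\pi,\mu)$ over admissible triggering policies $\pi$ and admissible control policies $\mu$. Moreover, the optimal triggering policy is a symmetric threshold policy ($\mathrm{VoI}_k$, and hence $\delta_k^*$, is an even function of $e_k$), and the optimal control policy is a certainty-equivalence policy.
   Context: Process: $x_{k+1}=A_kx_k+B_ku_k+w_k$, $k=0,\dots,N$, $x_k\in\mathbb{R}^n$, $u_k\in\mathbb{R}^m$, $x_0\sim\mathcal N(m_0,M_0)$, $w_k$ i.i.d. $\mathcal N(0,W_k)$, $W_k\succ0$, independent of $x_0$, $(A_k,B_k)$ controllable. Perfect information: the event trigger sees $x_k$ at time $k$ and chooses $\delta_k\in\{0,1\}$; $x_k$ is transmitted to the controller with one-step delay iff $\delta_k=1$. Information sets $\mathcal{I}^e_k=\{x_t:t\le k\}$, $\mathcal{I}^c_k=\{x_t:t<k,\delta_t=1\}$; the information associated with non-transmitted observations is discarded at the controller. Admissible policies: $\pi=\{\delta_k\}$ with $\delta_k$ measurable in $\mathcal{I}^e_k$; $\mu=\{u_k\}$ with $u_k$ measurable in $\mathcal{I}^c_k$. Cost: $\Psi(\pi,\mu)=\mathbb{E}\big[x_{N+1}^TQ_{N+1}x_{N+1}+\sum_{k=0}^N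 x_k^TQ_kx_k+u_k^TR_ku_k+\theta_k\delta_k\big]$ with $Q_k\succeq0$, $R_k\succ0$, $\theta_k=\ell_k\lambda\ge 0$. Riccati equation: $S_{N+1}=Q_{N+1}$, $S_k=Q_k+A_k^TS_{k+1}A_k-\Gamma_k$, $\Gamma_k=A_k^TS_{k+1}B_k(B_k^TS_{k+1}B_k+R_k)^{-1}B_k^TS_{k+1}A_k$ for $k\le N$, and $\Gamma_{N+1}=0$. Controller estimate: $\hat x_0=m_0$, $\hat x_k=A_{k-1}\hat x_{k-1}+B_{k-1}u_{k-1}+\delta_{k-1}A_{k-1}(x_{k-1}-\hat x_{k-1})$ (this equals $\mathbb{E}[x_k\mid\mathcal{I}^c_k]$), and $e_k=x_k-\hat x_k$. Value function: $V^e_{N+1}=0$, $V^e_k=\min_{\delta_k}\mathbb{E}[\theta_k\delta_k+e_{k+1}^T\Gamma_{k+1}e_{k+1}+V^e_{k+1}\mid\mathcal{I}^e_k]$, and $\varrho_k=\mathbb{E}[V^e_{k+1}\mid\mathcal{I}^e_k,\delta_k=0]-\mathbb{E}[V^e_{k+1}\mid\mathcal{I}^e_k,\delta_k=1]$. $\mathrm{VoI}_k$ is called the value of information at time $k$. A profile $(\pi^*,\mu^* )$ is a Nash equilibrium if $\Psi(\pi^*,\mu^* )\le\Psi(\pi,\mu^* )$ for all admissible $\pi$ and $\Psi(\pi^*,\mu^* )\le\Psi(\pi^*,\mu)$ for all admissible $\mu$. *)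

(* Defs.v *)
From HB Require Import structures.
From mathcomp Require Import all_boot all_order all_algebra.
From mathcomp Require Import all_classical all_reals all_analysis.

Set Implicit Arguments.
Unset Strict Implicit.
Unset Printing Implicit Defensive.

Import Order.TTheory GRing.Theory Num.Theory.
Local Open Scope classical_set_scope.
Local Open Scope ring_scope.

Section LinAlg.
Variable R : realType.

Definition qf (k : nat) (M : 'M[R]_k) (v : 'cV[R]_k) : R := (v^T *m M *m v) 0 0.

Definition psd (k : nat) (M : 'M[R]_k) : Prop :=
  M^T = M /\ forall v : 'cV[R]_k, 0 <= qf M v.
Definition pd (k : nat) (M : 'M[R]_k) : Prop :=
  M^T = M /\ forall v : 'cV[R]_k, v != 0 -> 0 < qf M v.

Definition controllable (n m : nat) (A : 'M[R]_n) (B : 'M[R]_(n, m)) : Prop :=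
  \rank (\mxrow_(i < n) (A ^+ i *m B)) = n.

(* conversions between column vectors and coordinate tuples
   (tuples carry MathComp-Analysis' product sigma-algebra = Borel on R^k) *)
Definition vtup (k : nat) (v : 'cV[R]_k) : k.-tuple R := [tuple v i 0 | i < k].
Definition tupv (k : nat) (t : k.-tuple R) : 'cV[R]_k := \col_i tnth t i.
End LinAlg.

Section Prob.
Variables (R : realType) (d : measure_display) (Omega : measurableType d)
  (P : probability Omega R).

Definition rvec_measurable (k : nat) (X : Omega -> 'cV[R]_k) : Prop :=
  measurable_fun [set: Omega] (fun w => vtup (X w)).

(* X ~ N(mu, M) (M possibly singular), defined by its characteristic function
   E[exp(i a^T X)] = exp(i a^T mu - a^T M a / 2), split in real/imag parts *)
Definition gaussian_vec (k : nat) (X : Omega -> 'cV[R]_k) (mu : 'cV[R]_k)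
    (M : 'M[R]_k) : Prop :=
  forall a : 'cV[R]_k,
    (\int[P]_w (cos ((a^T *m X w) 0 0))%:E =
       (cos ((a^T *m mu) 0 0) * expR (- (qf M a / 2)))%:E)%E /\
    (\int[P]_w (sin ((a^T *m X w) 0 0))%:E =
       (sin ((a^T *m mu) 0 0) * expR (- (qf M a / 2)))%:E)%E.

Definition mutually_independent (p k : nat) (Y : 'I_p -> Omega -> 'cV[R]_k) : Prop :=
  forall A : 'I_p -> set (k.-tuple R), (forall j, measurable (A j)) ->
    P (\bigcap_(j in [set: 'I_p]) ((fun w => vtup (Y j w)) @^-1` A j)) =
    (\prod_(j < p) P ((fun w => vtup (Y j w)) @^-1` A j))%E.
End Prob.

Section ETC.
Variables (R : realType) (n m N : nat)
  (A : nat -> 'M[R]_n) (B : nat -> 'M[R]_(n, m))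
  (Q : nat -> 'M[R]_n) (Rc : nat -> 'M[R]_m) (theta : nat -> R)
  (m0 : 'cV[R]_n).

(* Policies.  A triggering policy maps, at time k, the state history
   [x_0; ...; x_k] and the past control values [u_0; ...; u_(k-1)] to delta_k.  A control policy maps, at time k, the
   controller information [(delta_t, delta_t x_t) | t < k] to u_k. *)
Definition trig_policy := nat -> seq 'cV[R]_n -> seq 'cV[R]_m -> bool.
Definition ctrl_policy := nat -> seq (bool * 'cV[R]_n) -> 'cV[R]_m.

(* Borel measurability of the policy maps (Doob-Dynkin form of
   "delta_k measurable in I^e_k", "u_k measurable in I^c_k") *)
Definition admissible_trig (pi : trig_policy) : Prop :=
  forall k, (k <= N)%N ->
    measurable_fun [set: ((k.+1).-tuple (n.-tuple R) * k.-tuple (m.-tuple R))%type]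
      (fun h => pi k (map (@tupv R n) h.1) (map (@tupv R m) h.2)).

Definition admissible_ctrl (mu : ctrl_policy) : Prop :=
  forall k, (k <= N)%N -> forall i : 'I_m,
    measurable_fun [set: k.-tuple (bool * n.-tuple R)]
      (fun h => mu k [seq (p.1, tupv p.2) | p <- h] i 0).

(* closed-loop history after k steps: (states x_0..x_k,
   triggers delta_0..delta_(k-1), controls u_0..u_(k-1)) *)
Fixpoint hist (pi : trig_policy) (mu : ctrl_policy) (x0 : 'cV[R]_n)
    (w : nat -> 'cV[R]_n) (k : nat) :
    seq 'cV[R]_n * seq bool * seq 'cV[R]_m :=
  match k with
  | 0 => ([:: x0], [::], [::])
  | k'.+1 =>
    let: (xs, ds, us) := hist pi mu x0 w k' in
    let xk := last x0 xs in
    let dk := pi k' xs us in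
    let info := [seq (p.1, if p.1 then p.2 else 0) | p <- zip ds xs] in
    let uk := mu k' info in
    (rcons xs (A k' *m xk + B k' *m uk + w k'), rcons ds dk, rcons us uk)
  end.

Definition cost (pi : trig_policy) (mu : ctrl_policy) (x0 : 'cV[R]_n)
    (w : nat -> 'cV[R]_n) : R :=
  let: (xs, ds, us) := hist pi mu x0 w N.+1 in
  qf (Q N.+1) (nth 0 xs N.+1) +
  \sum_(k < N.+1) (qf (Q k) (nth 0 xs k) + qf (Rc k) (nth 0 us k)
                   + (nth false ds k)%:R * theta k).

(* Riccati equation, backwards: Sback j = S_(N+1-j) *)
Definition Gam_of (k : nat) (S' : 'M[R]_n) : 'M[R]_n :=
  (A k)^T *m S' *m B k *m invmx ((B k)^T *m S' *m B k + Rc k)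
    *m (B k)^T *m S' *m A k.

Fixpoint Sback (j : nat) : 'M[R]_n :=
  match j with
  | 0 => Q N.+1
  | j'.+1 => let k := (N - j')%N in let S' := Sback j' in
             Q k + (A k)^T *m S' *m A k - Gam_of k S'
  end.

Definition S (k : nat) : 'M[R]_n := Sback (N.+1 - k).
Definition Gam (k : nat) : 'M[R]_n := if (k <= N)%N then Gam_of k (S k.+1) else 0.
Definition Lgain (k : nat) : 'M[R]_(m, n) :=
  invmx ((B k)^T *m S k.+1 *m B k + Rc k) *m (B k)^T *m S k.+1 *m A k.

Fixpoint xhat_c (info : seq (bool * 'cV[R]_n)) (t : nat) : 'cV[R]_n :=
  match t with
  | 0 => m0
  | t'.+1 => let xh := xhat_c info t' in
             let p := nth (false, 0) info t' in
             A t' *m xh + B t' *m (- (Lgain t' *m xh))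
             + (if p.1 then A t' *m (p.2 - xh) else 0)
  end.

Definition mu_star : ctrl_policy := fun k info => - (Lgain k *m xhat_c info k).

Section Value.
Variables (d : measure_display) (Omega : measurableType d)
  (P : probability Omega R) (w : nat -> Omega -> 'cV[R]_n).

(* Value function V^e, as a function of e_k, backwards: Vback j = V^e_(N+1-j).
   Conditional expectations given I^e_k are computed using
   e_(k+1) = (1 - delta_k) A_k e_k + w_k with w_k independent of I^e_k. *)
Fixpoint Vback (j : nat) : 'cV[R]_n -> \bar R :=
  match j with
  | 0 => fun _ => 0%E
  | j'.+1 => let k := (N - j')%N in let Vn := Vback j' in
    fun e =>
      Order.min
        (\int[P]_o ((qf (Gam k.+1) (A k *m e + w k o)%R)%:E + Vn (A k *m e + w k o)%R))%E
        ((theta k)%:E + \int[P]_o ((qf (Gam k.+1) (w k o))%:E + Vn (w k o)))%E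
  end.

Definition Ve (k : nat) : 'cV[R]_n -> \bar R := Vback (N.+1 - k).

(* varrho_k = E[V^e_(k+1) | I^e_k, delta_k = 0] - E[V^e_(k+1) | I^e_k, delta_k = 1] *)
Definition varrho (k : nat) (e : 'cV[R]_n) : \bar R :=
  (\int[P]_o Ve k.+1 (A k *m e + w k o)%R - \int[P]_o Ve k.+1 (w k o))%E.

Definition VoI (k : nat) (e : 'cV[R]_n) : \bar R :=
  ((qf (Gam k.+1) (A k *m e) - theta k)%:E + varrho k e)%E.

Definition trig_rule (k : nat) (e : 'cV[R]_n) : bool := (0 <= VoI k e)%E.

(* Estimate xhat_t as in the context, recomputed by the triggering agent from
   x_0..x_k, past controls and its own past decisions. *)
Fixpoint xhat_e (xs : seq 'cV[R]_n) (us : seq 'cV[R]_m) (t : nat) : 'cV[R]_n :=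
  match t with
  | 0 => m0
  | t'.+1 => let xh := xhat_e xs us t' in
             let e := nth 0 xs t' - xh in
             A t' *m xh + B t' *m nth 0 us t'
             + (if trig_rule t' e then A t' *m e else 0)
  end.

Definition pi_star : trig_policy :=
  fun k xs us => trig_rule k (nth 0 xs k - xhat_e xs us k).

Definition Psi (x0 : Omega -> 'cV[R]_n) (pi : trig_policy) (mu : ctrl_policy) : \bar R :=
  (\int[P]_o (cost pi mu (x0 o) (fun k => w k o))%:E)%E.
End Value.
End ETC.

(* Main.v *)
Require Import Defs.
From HB Require Import structures.
From mathcomp Require Import all_boot all_order all_algebra.
From mathcomp Require Import all_classical all_reals all_analysis.
From mathcomp Require Import measurable_realfun.
From mathcomp Require Import ring lra.
Import Order.TTheory GRing.Theory Num.Theory.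
Import numFieldNormedType.Exports.
Local Open Scope classical_set_scope.
Local Open Scope ring_scope.

(* Completing the square along the Riccati recursion turns the cost into a
   policy-independent noise term, mean-zero terms, and the sum over k of
   |u_k + L_k x_k|^2 (in the metric Lam_k = B_k^T S_(k+1) B_k + R_k) + theta_k delta_k.

   Against mu_star, u_k + L_k x_k = L_k e_k and e_(k+1) = (1 - delta_k) A_k e_k + w_k,
   so the trigger faces a Markov decision problem in the error alone: dynamic
   programming, with Fubini for the independent noise w_k, gives optimality of the
   rule VoI_k >= 0.

   Against pi_star, the errors and the triggers do not depend on the control
   policy.  The rule is even in e_k and the noise is symmetric, so by induction
   the error is symmetric conditionally on everything the controller observes,
   silences included; the cross term between u_k + L_k xhat_k and e_k then has mean
   zero, and u_k = - L_k xhat_k is optimal.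

   Of the Gaussian laws only symmetry and finite second moments are used.  Both
   are read off the characteristic function: symmetry by uniqueness of
   characteristic functions, second moments by Fatou's lemma applied to
   2 k^2 (1 - cos (x / k)). *)

Set Implicit Arguments.
Unset Strict Implicit.
Unset Printing Implicit Defensive.

(** * Uniqueness of characteristic functions *)

(** Conditional expectations are never formed. Conditioning on the past becomes an iterated integral
    over the independent current noise. Conditional symmetry becomes invariance, under reversal of
    the error, of the integrals of nonnegative test functions. Means are shown to vanish by equating
    positive and negative parts. Integrability differs between the two best-response problems. Since
    [mu_star] is linear in the estimate, every triggering policy played against it keeps the loop
    square integrable. Against [pi_star] a control policy may have infinite cost, and then there is
    nothing to prove; a finite cost forces square-integrable controls, because each R_k is positive
    definite. The obstacle on the controller's side is that silence is informative: under a general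
    triggering rule the estimate, which ignores silences, could be biased. *)

Section SignIteration.
Variable R : realType.

(** The Newton-Schulz iteration for the sign function: an odd cubic with fixed points -1, 0, 1 and
    critical points at -1 and 1. Being a polynomial, it does not leave an algebra of functions. *)
Definition sgstep (t : R) : R := (3 * t - t ^+ 3) / 2.

Lemma sgstepN t : sgstep (- t) = - sgstep t.
Proof. by rewrite /sgstep; field. Qed.

Lemma iter_sgstepN k t : iter k sgstep (- t) = - iter k sgstep t.
Proof. by elim: k => //= k ->; rewrite sgstepN. Qed.

(* [1 - p t = (1 - t) * (1 - (t + t^2) / 2)] for [p = sgstep], so the distance to
   1 decays geometrically. *)
Lemma iter_sgstep_bounds k (t : R) : 0 <= t <= 1 ->
  t <= iter k sgstep t <= 1 /\ 1 - iter k sgstep t <= (1 - t / 2) ^+ k.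
Proof.
move=> /andP[t0 t1]; elim: k => [|k [/andP[tx x1] Hx]] /=.
  by rewrite expr0 lexx t1; split => //; lra.
set x := iter k sgstep t in tx x1 Hx *.
have E : 1 - sgstep x = (1 - x) * (1 - (x + x ^+ 2) / 2).
  by rewrite /sgstep; field.
have x2 : 0 <= x ^+ 2 by apply: sqr_ge0.
have x2' : x ^+ 2 <= x.
  by rewrite expr2 -[leRHS]mulr1 ler_wpM2l//; lra.
have a0 : 0 <= 1 - (x + x ^+ 2) / 2 by lra.
split.
  apply/andP; split.
    have: 1 - sgstep x <= 1 - x.
      rewrite E -[leRHS]mulr1 ler_wpM2l//; lra.
    lra.
  rewrite -subr_ge0 E mulr_ge0//; lra.
rewrite E [leRHS]exprSr; apply: ler_pM => //; lra.
Qed.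

Lemma cvg_iter_sgstep (t : R) : `|t| <= 1 ->
  iter k sgstep t @[k --> \oo] --> Num.sg t.
Proof.
have H (u : R) : 0 < u -> u <= 1 -> iter k sgstep u @[k --> \oo] --> (1 : R).
  move=> u0 u1.
  apply: (@squeeze_cvgr _ _ _ _ (fun k => 1 - (1 - u / 2) ^+ k) (fun=> 1)).
  - apply: nearW => k.
    have [|/andP[_ H1] H2] := @iter_sgstep_bounds k u; first by rewrite u1 ltW.
    by rewrite H1 andbT lerBlDr -lerBlDl.
  - rewrite -[X in _ --> X]subr0; apply: cvgB; first exact: cvg_cst.
    apply: cvg_expr; rewrite ltr_norml; apply/andP; split; lra.
  - exact: cvg_cst.
rewrite ler_norml => /andP[tN1 t1].
have [t0|t0|->] := ltgtP t 0.
- rewrite ltr0_sg// -[t]opprK; under eq_fun do rewrite iter_sgstepN.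
  by apply: cvgN; apply: H; lra.
- by rewrite gtr0_sg//; exact: H.
- rewrite sgr0; have E k : iter k sgstep 0 = 0 :> R.
    by elim: k => //= k ->; rewrite /sgstep; field.
  by under eq_fun do rewrite E; exact: cvg_cst.
Qed.

(** Recovers the sign of an unbounded quantity from bounded trigonometric functions: once the
    argument is smaller than pi in absolute value, sine has its sign, so the sequence is eventually
    constant. *)
Lemma cvg_sg_sin_scale (x : R) :
  Num.sg (sin (x / k.+1%:R)) @[k --> \oo] --> Num.sg x.
Proof.
apply: cvg_near_cst.
have [k0 k0P] : exists k0 : nat, `|x| < k0.+1%:R * pi.
  exists (Num.trunc (`|x| / pi)).
  by rewrite -ltr_pdivrMr ?pi_gt0// truncnS_gt.
near=> k.
have kk0 : (k0 <= k)%N by near: k; exact: nbhs_infty_ge.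
have H : `|x / k.+1%:R| < pi.
  rewrite normrM normfV (ger0_norm (ler0n _ _)) ltr_pdivrMr ?ltr0n//.
  apply: lt_le_trans k0P _; rewrite mulrC ler_pM2l ?pi_gt0// ler_nat ltnS//.
have S y : 0 < y -> y < pi -> Num.sg (sin y) = 1 :> R.
  by move=> y0 y1; rewrite gtr0_sg// sin_gt0_pi// y0 y1.
have k0' : 0 < (k.+1%:R : R)^-1 by rewrite invr_gt0 ltr0n.
move: H; rewrite ltr_norml => /andP[H1 H2].
have [x0|x0|->] := ltgtP x 0.
- rewrite [RHS]ltr0_sg// -[x]opprK mulNr sinN sgrN S//.
  + by rewrite mulr_gt0// oppr_gt0.
  + by rewrite mulNr ltrNl.
- by rewrite [RHS]gtr0_sg// S// mulr_gt0.
- by rewrite mul0r sin0.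
Unshelve. all: by end_near. Qed.

End SignIteration.

(** * Equality of laws from equality of trigonometric integrals *)

Section CharacteristicFunction.
Context (R : realType) (d : measure_display) (Omega : measurableType d)
  (P : probability Omega R) (n : nat).
Local Notation T := (n.-tuple R).

Definition tdot (a : 'I_n -> R) (t : T) : R := \sum_i a i * tnth t i.

Lemma measurable_tdot a : measurable_fun [set: T] (tdot a).
Proof.
apply: measurable_sum => i; apply: measurable_funM => //.
exact: measurable_tnth.
Qed.

Lemma tdotD a b t : tdot (fun i => a i + b i) t = tdot a t + tdot b t.
Proof. by rewrite -big_split; apply: eq_bigr => i _; rewrite mulrDl. Qed.

Lemma tdotN a t : tdot (fun i => - a i) t = - tdot a t.
Proof. by rewrite -sumrN; apply: eq_bigr => i _; rewrite mulNr. Qed.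

Lemma tdotB a b t : tdot (fun i => a i - b i) t = tdot a t - tdot b t.
Proof. by rewrite (tdotD a (fun i => - b i)) tdotN. Qed.

Definition bmeas (F : T -> R) : Prop :=
  measurable_fun setT F /\ exists M : R, forall t, `|F t| <= M.

Lemma bmeasM F G : bmeas F -> bmeas G -> bmeas (fun t => F t * G t).
Proof.
move=> [mF [M FM]] [mG [K GK]]; split; first exact: measurable_funM.
by exists (M * K) => t; rewrite normrM ler_pM.
Qed.

Lemma bmeasD F G : bmeas F -> bmeas G -> bmeas (fun t => F t + G t).
Proof.
move=> [mF [M FM]] [mG [K GK]]; split; first exact: measurable_funD.
by exists (M + K) => t; rewrite (le_trans (ler_normD _ _))// lerD.
Qed.

Lemma bmeas_cst c : bmeas (fun=> c).
Proof. by split; [exact: measurable_cst | exists `|c|]. Qed.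

Lemma bmeas_cos a : bmeas (fun t => cos (tdot a t)).
Proof.
split; last first.
  by exists 1 => t; rewrite ler_norml cos_geN1 cos_le1.
apply: measurableT_comp; last exact: measurable_tdot.
by apply: continuous_measurable_fun; exact: continuous_cos.
Qed.

Lemma bmeas_sin a : bmeas (fun t => sin (tdot a t)).
Proof.
split; last first.
  by exists 1 => t; rewrite ler_norml sin_geN1 sin_le1.
apply: measurableT_comp; last exact: measurable_tdot.
by apply: continuous_measurable_fun; exact: continuous_sin.
Qed.

Variables (Y Z : Omega -> T).
Hypotheses (mY : measurable_fun setT Y) (mZ : measurable_fun setT Z).

Lemma bmeas_integrable F (X : Omega -> T) : bmeas F -> measurable_fun setT X ->
  P.-integrable setT (EFin \o (fun o => F (X o))).
Proof.
move=> [mF [M FM]] mX; apply: measurable_bounded_integrable => //.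
- exact: fin_num_fun_lty.
- exact: measurableT_comp.
- by exists M; split; [exact: num_real|move=> N MN o _ /=; exact: le_trans (FM _) (ltW MN)].
Qed.

(** Boundedness is bundled with the equality so that both integrals are finite and the class is
    linear. *)
Definition agree (F : T -> R) : Prop :=
  bmeas F /\ (\int[P]_o (F (Y o))%:E = \int[P]_o (F (Z o))%:E)%E.

Lemma agreeD F G : agree F -> agree G -> agree (fun t => F t + G t).
Proof.
move=> [bF EF] [bG EG]; split; first exact: bmeasD.
under eq_integral do rewrite EFinD.
under [RHS]eq_integral do rewrite EFinD.
by rewrite !integralD// ?EF ?EG//; exact: bmeas_integrable.
Qed.

Lemma agreeZ c F : agree F -> agree (fun t => c * F t).
Proof.
move=> [bF EF]; split; first exact: bmeasM (bmeas_cst c) bF.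
under eq_integral do rewrite EFinM.
under [RHS]eq_integral do rewrite EFinM.
by rewrite !integralZl// ?EF//; exact: bmeas_integrable.
Qed.

Lemma agree_ext F G : F =1 G -> agree F -> agree G.
Proof. by move=> /funext ->. Qed.

Lemma agree_lim (F_ : nat -> T -> R) (F : T -> R) (M : R) :
  (forall k, agree (F_ k)) -> (forall k t, `|F_ k t| <= M) ->
  (forall t, F_ k t @[k --> \oo] --> F t) -> agree F.
Proof.
move=> aF bF cF; split.
  split; first by apply: (@measurable_fun_cvg _ _ _ _ F_) => // k; case: (aF k) => -[].
  exists M => t; rewrite -(cvg_lim _ (cvg_norm (cF t)))//.
  apply: limr_le; first by apply/cvg_ex; eexists; exact: cvg_norm (cF t).
  by apply: nearW => k; exact: bF.
have L (X : Omega -> T) : measurable_fun setT X ->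
    (\int[P]_o (F_ k (X o))%:E @[k --> \oo] --> \int[P]_o (F (X o))%:E)%E.
  move=> mX.
  apply: (@dominated_cvg _ _ _ P setT _ (fun k o => (F_ k (X o))%:E) _ (fun=> M%:E)) => //.
  - move=> k; apply/measurable_EFinP; apply: measurableT_comp => //.
    by case: (aF k) => -[].
  - by move=> o _; apply: cvg_EFin; [exact: nearW | exact: cF].
  - exact: finite_measure_integrable_cst.
  - by move=> k o _; rewrite lee_fin.
have := L _ mY; under eq_fun do rewrite (aF _).2.
by move=> H; apply: (cvg_unique _ H (L _ mZ)).
Qed.

(** The laws of [Y] and [Z], weighted by the density [g], have the same Fourier transform. *)
Definition trig_agree (g : T -> R) : Prop := forall a,
  agree (fun t => g t * cos (tdot a t)) /\ agree (fun t => g t * sin (tdot a t)).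

(* Multipliers form an algebra closed under bounded pointwise limits and
   containing the trigonometric functions, hence all indicators of measurable
   sets: this replaces Fourier inversion. *)
Definition multiplier (h : T -> R) : Prop :=
  bmeas h /\
  forall g, bmeas g -> trig_agree g -> trig_agree (fun t => h t * g t).

Lemma multiplierM h1 h2 : multiplier h1 -> multiplier h2 ->
  multiplier (fun t => h1 t * h2 t).
Proof.
move=> [b1 m1] [b2 m2]; split; first exact: bmeasM.
move=> g bg tg.
have -> : (fun t => h1 t * h2 t * g t) = (fun t => h1 t * (h2 t * g t)).
  by apply/funext => t; rewrite mulrA.
by apply: m1; [exact: bmeasM | exact: m2].
Qed.

Lemma multiplierD h1 h2 : multiplier h1 -> multiplier h2 ->
  multiplier (fun t => h1 t + h2 t).
Proof.
move=> [b1 m1] [b2 m2]; split; first exact: bmeasD.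
move=> g bg tg a; have [c1 s1] := m1 g bg tg a; have [c2 s2] := m2 g bg tg a.
by split; [apply: agree_ext (agreeD c1 c2)|apply: agree_ext (agreeD s1 s2)] => t;
  ring.
Qed.

Lemma multiplier_cst c : multiplier (fun=> c).
Proof.
split; first exact: bmeas_cst.
move=> g bg tg a; have [ca sa] := tg a.
by split; [apply: agree_ext (agreeZ c ca)|apply: agree_ext (agreeZ c sa)] => t;
  rewrite mulrA.
Qed.

Lemma multiplier_ext h1 h2 : h1 =1 h2 -> multiplier h1 -> multiplier h2.
Proof. by move=> /funext ->. Qed.

Lemma multiplier_lim (h_ : nat -> T -> R) (h : T -> R) (M : R) :
  (forall k, multiplier (h_ k)) -> (forall k t, `|h_ k t| <= M) ->
  (forall t, h_ k t @[k --> \oo] --> h t) -> multiplier h.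
Proof.
move=> mh bh ch; split.
  split; first by apply: (@measurable_fun_cvg _ _ _ _ h_) => // k; case: (mh k) => -[].
  exists M => t; rewrite -(cvg_lim _ (cvg_norm (ch t)))//.
  apply: limr_le; first by apply/cvg_ex; eexists; exact: cvg_norm (ch t).
  by apply: nearW => k; exact: bh.
move=> g [mg [K gK]] tg a.
have L (f : T -> R) : (forall t, `|f t| <= 1) ->
    (forall k, agree (fun t => h_ k t * g t * f t)) ->
    agree (fun t => h t * g t * f t).
  move=> f1 H; apply: (agree_lim (M := M * K * 1) H).
    by move=> k t; rewrite !normrM ler_pM// ?mulr_ge0// ler_pM.
  by move=> t; apply: cvgMl; apply: cvgMl; exact: ch.
split; apply: L => [t|k].
- by rewrite ler_norml cos_geN1 cos_le1.
- by have [] := (mh k).2 g (conj mg (ex_intro _ K gK)) tg a.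
- by rewrite ler_norml sin_geN1 sin_le1.
- by have [] := (mh k).2 g (conj mg (ex_intro _ K gK)) tg a.
Qed.

(** By the product-to-sum formulas, multiplying by a trigonometric function of frequency [b] only
    shifts the frequency [a] to [a + b] and [a - b]. *)
Lemma multiplier_cos b : multiplier (fun t => cos (tdot b t)).
Proof.
split; first exact: bmeas_cos.
move=> g bg tg a.
have [c1 s1] := tg (fun i => a i + b i); have [c2 s2] := tg (fun i => a i - b i).
split.
  apply: agree_ext (agreeZ (1/2) (agreeD c1 c2)) => t.
  by rewrite tdotD tdotB cosD cosB; field.
apply: agree_ext (agreeZ (1/2) (agreeD s1 s2)) => t.
by rewrite tdotD tdotB sinD sinB; field.
Qed.

Lemma multiplier_sin b : multiplier (fun t => sin (tdot b t)).
Proof.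
split; first exact: bmeas_sin.
move=> g bg tg a.
have [c1 s1] := tg (fun i => a i + b i); have [c2 s2] := tg (fun i => a i - b i).
split.
  apply: agree_ext (agreeD (agreeZ (1/2) s1) (agreeZ (- (1/2)) s2)) => t.
  by rewrite tdotD tdotB sinD sinB; field.
apply: agree_ext (agreeD (agreeZ (- (1/2)) c1) (agreeZ (1/2) c2)) => t.
by rewrite tdotD tdotB cosD cosB; field.
Qed.

Lemma multiplier_sg h : multiplier h -> (forall t, `|h t| <= 1) ->
  multiplier (fun t => Num.sg (h t)).
Proof.
move=> mh h1.
apply: (@multiplier_lim (fun k t => iter k (@sgstep R) (h t)) _ 1).
- elim=> //= k IH.
  have H2 := multiplierM (multiplierM IH IH) IH.
  apply: multiplier_ext (multiplierD (multiplierM (multiplier_cst (3/2)) IH)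
    (multiplierM (multiplier_cst (-(1/2))) H2)) => t.
  by rewrite /sgstep; field.
- move=> k t; have := h1 t; case: (lerP 0 (h t)) => h0.
    rewrite (ger0_norm h0) => ht1.
    have [|/andP[H1 H2] _] := @iter_sgstep_bounds _ k (h t); first by rewrite h0.
    by rewrite ger0_norm// (le_trans h0).
  rewrite (ltr0_norm h0) -normrN -iter_sgstepN => ht1.
  have h0' : 0 <= - h t by rewrite oppr_ge0 ltW.
  have [|/andP[H1 H2] _] := @iter_sgstep_bounds _ k (- h t); first by rewrite h0'.
  by rewrite ger0_norm// (le_trans h0').
- by move=> t; exact: cvg_iter_sgstep.
Qed.

(** The subtraction formula makes sin ((t_j - c) / (k + 1)) a trigonometric polynomial with values
    in [-1, 1]; its sign is a multiplier, and these signs converge to the sign of t_j - c. *)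
Lemma multiplier_sg_coord j c : multiplier (fun t => Num.sg (tnth t j - c)).
Proof.
apply: (@multiplier_lim (fun k t => Num.sg (sin ((tnth t j - c) / k.+1%:R))) _ 1).
- move=> k; apply: multiplier_sg; last first.
    by move=> t; rewrite ler_norml sin_geN1 sin_le1.
  pose a i : R := if i == j then k.+1%:R^-1 else 0.
  have E t : tdot a t = tnth t j / k.+1%:R.
    rewrite /tdot (bigD1 j)//= big1 ?addr0 /a ?eqxx 1?mulrC// => i /negPf ->.
    by rewrite mul0r.
  apply: multiplier_ext (multiplierD
    (multiplierM (multiplier_cst (cos (c / k.+1%:R))) (multiplier_sin a))
    (multiplierM (multiplier_cst (- sin (c / k.+1%:R))) (multiplier_cos a))) => t.
  by rewrite E mulrBl sinB; ring.
- by move=> k t; rewrite normr_sg; case: (_ != 0).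
- by move=> t; exact: cvg_sg_sin_scale.
Qed.

Definition multiplier_set (B : set T) : Prop := multiplier (\1_B).

Lemma multiplier_set_gt j c : multiplier_set [set t | c < tnth t j].
Proof.
have H := multiplier_sg_coord j c.
(* For a sign s, (s + s^2) / 2 is 1 when s = 1 and 0 when s is 0 or -1. *)
apply: multiplier_ext (multiplierM (multiplier_cst (1/2)) (multiplierD H (multiplierM H H))) => t.
rewrite indicE; have [t0|t0|t0] := ltgtP (tnth t j) c.
- by rewrite ltr0_sg ?subr_lt0// memNset/= ?ltNge ?ltW//; ring.
- by rewrite gtr0_sg ?subr_gt0// mem_set//=; field.
- by rewrite t0 subrr sgr0 memNset/= ?t0 ?ltxx//; ring.
Qed.

(** Multipliers are closed under products, so finite unions are reached by inclusion-exclusion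
    without disjointness, and no pi-lambda argument is needed; bounded limits give countable
    unions. *)
Lemma multiplier_set_sigma_algebra : sigma_algebra setT multiplier_set.
Proof.
split.
- apply: multiplier_ext (multiplier_cst 0) => t; by rewrite indic0.
- move=> A mA.
  apply: multiplier_ext (multiplierD (multiplier_cst 1) (multiplierM (multiplier_cst (-1)) mA)) => t.
  by rewrite !indicE in_setD in_setT; case: (t \in A) => /=; ring.
- move=> A mA.
  have U k : multiplier_set (\big[setU/set0]_(i < k) A i).
    elim: k => [|k IH].
      by rewrite big_ord0; apply: multiplier_ext (multiplier_cst 0) => t; rewrite indic0.
    rewrite big_ord_recr/=.
    apply: multiplier_ext (multiplierD (multiplierD IH (mA k))
      (multiplierM (multiplier_cst (-1)) (multiplierM IH (mA k)))) => t.
    by rewrite !indicE in_setU; case: (t \in _); case: (t \in _) => /=; ring.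
  apply: (multiplier_lim (M := 1) U).
    by move=> k t; rewrite indicE; case: (_ \in _); rewrite ?normr0 ?normr1.
  move=> t; apply: cvg_near_cst; rewrite !indicE.
  have [[k0 _ Ak0]|nA] := pselect ((\bigcup_k A k) t).
    near=> k; rewrite indicE !mem_set//; first by exists k0.
    rewrite -bigcup_mkord; exists k0 => //=.
    by near: k; exact: nbhs_infty_gt.
  near=> k; rewrite indicE !memNset//.
  by rewrite -bigcup_mkord => -[i _ Ai]; apply: nA; exists i.
Unshelve. all: by end_near. Qed.

Lemma multiplier_measurable_set B : measurable B -> multiplier_set B.
Proof.
have sg := multiplier_set_sigma_algebra.
move: B; apply: smallest_sub => // B.
rewrite -bigcup_seq/= => -[j _] [C mC <-]; rewrite setTI.
(* The sets of reals whose preimage under coordinate j is good form a sigma-algebra, so it is enough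
   to treat open rays. *)
have sgC : sigma_algebra setT [set C | multiplier_set ((fun t : T => tnth t j) @^-1` C)].
  case: sg => g0 gC gU; split => /=.
  - by rewrite preimage_set0.
  - by move=> A; rewrite setTD -preimage_setC -setTD; exact: gC.
  - by move=> A mA; rewrite preimage_bigcup; exact: gU.
have GC : @RGenOInfty.G R `<=` [set C | multiplier_set ((fun t : T => tnth t j) @^-1` C)].
  move=> _ [c ->] /=.
  rewrite (_ : _ @^-1` _ = [set t | c < tnth t j]); first exact: multiplier_set_gt.
  by apply/seteqP; split => t /=; rewrite in_itv/= andbT.
by apply: (smallest_sub sgC GC); move: mC; rewrite [X in X C -> _]RGenOInfty.measurableE.
Qed.

Hypothesis cosYZ : forall a, (\int[P]_o (cos (tdot a (Y o)))%:E
  = \int[P]_o (cos (tdot a (Z o)))%:E)%E.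
Hypothesis sinYZ : forall a, (\int[P]_o (sin (tdot a (Y o)))%:E
  = \int[P]_o (sin (tdot a (Z o)))%:E)%E.

Theorem characteristic_function_unique B : measurable B ->
  P (Y @^-1` B) = P (Z @^-1` B).
Proof.
move=> mB.
have t1 : trig_agree (fun=> 1).
  move=> a; split.
    by apply: (@agree_ext (fun t => cos (tdot a t))) => [t|]; [rewrite mul1r|split; [exact: bmeas_cos|]].
  by apply: (@agree_ext (fun t => sin (tdot a t))) => [t|]; [rewrite mul1r|split; [exact: bmeas_sin|]].
(* The frequency is 0, so the cosine is 1 and only the integrals of the indicator remain. *)
have [_ /(_ _ (bmeas_cst 1) t1 (fun=> 0))[[_ H] _]] := multiplier_measurable_set mB.
have E (X : Omega -> T) : measurable_fun setT X ->
    (\int[P]_o (\1_B (X o) * 1 * cos (tdot (fun=> 0) (X o)))%:E)%E = P (X @^-1` B).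
  move=> mX; rewrite -(setIT (X @^-1` B)) -integral_indic//; last first.
    by rewrite -[X in measurable X]setTI; exact: mX.
  apply: eq_integral => o _; rewrite mulr1 /tdot big1 ?cos0 ?mulr1//.
  by move=> i _; rewrite mul0r.
by rewrite -!E.
Qed.

End CharacteristicFunction.

(** * Gaussian vectors: symmetry and second moments *)

Section VectorMeasurability.
Context (R : realType).

Lemma vtupK k (v : 'cV[R]_k) : tupv (vtup v) = v.
Proof. by apply/colP => i; rewrite !mxE tnth_mktuple. Qed.

Section mvec.
Context (d : measure_display) (T : measurableType d).

Definition mvec k (X : T -> 'cV[R]_k) : Prop :=
  forall i, measurable_fun setT (fun t => X t i 0).

Lemma mvec_vtup k (X : T -> 'cV[R]_k) :
  measurable_fun setT (fun t => vtup (X t)) <-> mvec X.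
Proof.
split=> [/measurable_fun_tnthP H i|H].
  by apply: eq_measurable_fun (H i) => t _ /=; rewrite tnth_mktuple.
apply/measurable_fun_tnthP => i.
by apply: eq_measurable_fun (H i) => t _ /=; rewrite tnth_mktuple.
Qed.

Lemma mvec_cst k (v : 'cV[R]_k) : mvec (fun=> v).
Proof. by move=> i; exact: measurable_cst. Qed.

Lemma mvecD k (X Y : T -> 'cV[R]_k) : mvec X -> mvec Y -> mvec (fun t => X t + Y t).
Proof.
by move=> mX mY i; under eq_fun do rewrite mxE; exact: measurable_funD.
Qed.

Lemma mvecN k (X : T -> 'cV[R]_k) : mvec X -> mvec (fun t => - X t).
Proof.
by move=> mX i; under eq_fun do rewrite mxE; exact: measurable_funN.
Qed.

Lemma mvecB k (X Y : T -> 'cV[R]_k) : mvec X -> mvec Y -> mvec (fun t => X t - Y t).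
Proof. by move=> mX mY; apply: mvecD => //; exact: mvecN. Qed.

Lemma mvecM k l (M : 'M[R]_(k, l)) (X : T -> 'cV[R]_l) :
  mvec X -> mvec (fun t => M *m X t).
Proof.
move=> mX i; under eq_fun do rewrite mxE.
by apply: measurable_sum => j; exact: measurable_funM.
Qed.

Lemma mvec_if k (b : T -> bool) (X Y : T -> 'cV[R]_k) :
  measurable_fun setT b -> mvec X -> mvec Y ->
  mvec (fun t => if b t then X t else Y t).
Proof.
move=> mb mX mY i.
under eq_fun do rewrite (fun_if (fun v : 'cV[R]_k => v i 0)).
exact: measurable_fun_ifT.
Qed.

Lemma measurable_bilinear k l (M : 'M[R]_(k, l)) (X : T -> 'cV[R]_k)
    (Y : T -> 'cV[R]_l) : mvec X -> mvec Y ->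
  measurable_fun setT (fun t => ((X t)^T *m M *m Y t) 0 0).
Proof.
move=> mX mY; under eq_fun do rewrite -mulmxA mxE.
apply: measurable_sum => j; apply: measurable_funM.
  by under eq_fun do rewrite mxE; exact: mX.
exact: mvecM.
Qed.

Lemma measurable_qf k (M : 'M[R]_k) (X : T -> 'cV[R]_k) :
  mvec X -> measurable_fun setT (fun t => qf M (X t)).
Proof. by move=> mX; exact: measurable_bilinear. Qed.

End mvec.

Lemma mvec_comp d d' (T : measurableType d) (T' : measurableType d') k
    (f : T -> T') (X : T' -> 'cV[R]_k) :
  measurable_fun setT f -> mvec X -> mvec (fun t => X (f t)).
Proof. by move=> mf mX i; exact: (measurableT_comp (mX i) mf). Qed.

Lemma mvec_tupv k : mvec (@tupv R k).
Proof.
by move=> i; under eq_fun do rewrite mxE; exact: measurable_tnth.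
Qed.

(* Column vectors carry no measurable structure: maps out of them are measured
   on coordinate tuples. *)
Definition mcv k d (T : measurableType d) (F : 'cV[R]_k -> T) : Prop :=
  measurable_fun setT (fun t => F (tupv t)).

Lemma mcv_comp k d d' (T : measurableType d) (T' : measurableType d')
    (F : 'cV[R]_k -> T') (X : T -> 'cV[R]_k) :
  mcv F -> mvec X -> measurable_fun setT (fun t => F (X t)).
Proof.
move=> mF /mvec_vtup mX.
by apply: eq_measurable_fun (measurableT_comp mF mX) => t _ /=; rewrite vtupK.
Qed.

End VectorMeasurability.

Section GaussianSymmetry.
Context (R : realType) (d : measure_display) (Omega : measurableType d)
  (P : probability Omega R).

(** Tested on nonnegative extended-valued functions, so that value functions can be inserted with no
    integrability condition. *)
Definition symmetric_law k (X : Omega -> 'cV[R]_k) : Prop :=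
  forall F : 'cV[R]_k -> \bar R, mcv F -> (forall v, 0 <= F v)%E ->
  (\int[P]_o F (X o) = \int[P]_o F (- X o)%R)%E.

(** The cosine transforms of [X] and [- X] always agree and their sine transforms are opposite; if
    the latter vanish, the two laws have the same characteristic function. *)
Lemma symmetric_law_sin k (X : Omega -> 'cV[R]_k) : mvec X ->
  (forall a : 'cV[R]_k, (\int[P]_o (sin ((a^T *m X o) 0 0))%:E = 0)%E) ->
  symmetric_law X.
Proof.
move=> mX sX F mF F0.
have mY : measurable_fun setT (fun o => vtup (X o)) by apply/mvec_vtup.
have mZ : measurable_fun setT (fun o => vtup (- X o)) by apply/mvec_vtup/mvecN.
have tdotE (a : 'I_k -> R) v : tdot a (vtup v) = ((\col_i a i)^T *m v) 0 0.
  rewrite mxE; apply: eq_bigr => i _; by rewrite tnth_mktuple !mxE.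
have U := @characteristic_function_unique R d Omega P k _ _ mY mZ.
have E (Z : Omega -> 'cV[R]_k) (mZ' : measurable_fun setT (fun o => vtup (Z o))) :
    (\int[P]_o F (Z o) = \int[pushforward P (fun o => vtup (Z o))]_t F (tupv t))%E.
  rewrite ge0_integral_pushforward//.
  by apply: eq_integral => o _ /=; rewrite vtupK.
rewrite (E _ mY) (E _ mZ); apply: eq_measure_integral => B mB _.
apply: U => //= a.
  by apply: eq_integral => o _; rewrite !tdotE mulmxN [in RHS]mxE cosN.
under eq_integral do rewrite tdotE.
under [RHS]eq_integral do rewrite tdotE mulmxN -mulNmx -linearN.
by rewrite !sX.
Qed.

Lemma gaussian_centered k (X : Omega -> 'cV[R]_k) mu M : mvec X ->
  gaussian_vec P X mu M -> forall a : 'cV[R]_k,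
  (\int[P]_o (cos ((a^T *m (X o - mu)) 0 0))%:E = (expR (- (qf M a / 2)))%:E)%E /\
  (\int[P]_o (sin ((a^T *m (X o - mu)) 0 0))%:E = 0)%E.
Proof.
move=> mX gX a; have [gc gs] := gX a.
have mU : measurable_fun setT (fun o => (a^T *m X o) 0 0) by exact: mvecM.
have B (f : R -> R) : continuous f -> (forall x, `|f x| <= 1) ->
    P.-integrable setT (fun o => (f ((a^T *m X o) 0 0))%:E).
  move=> cf f1; apply: measurable_bounded_integrable => //.
  - exact: fin_num_fun_lty.
  - by apply: measurableT_comp => //; exact: continuous_measurable_fun.
  - by exists 1; split; [exact: num_real|move=> K K1 o _ /=; exact: le_trans (f1 _) (ltW K1)].
have ic := B _ (@continuous_cos R) (fun x => cos_max x).
have isn := B _ (@continuous_sin R) (fun x => sin_max x).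
set m := (a^T *m mu) 0 0 in gc gs.
have dE o : (a^T *m (X o - mu)) 0 0 = (a^T *m X o) 0 0 - m.
  by rewrite mulmxBr [LHS]mxE; congr (_ + _); rewrite [LHS]mxE.
split.
  under eq_integral => o _.
    rewrite dE cosB (mulrC (cos ((a^T *m X o) 0 0))) (mulrC (sin ((a^T *m X o) 0 0))) EFinD !EFinM.
    over.
  rewrite integralD//; [|exact: integrableZl..].
  rewrite !integralZl// gc gs -!EFinM -EFinD; congr EFin.
  by have := cos2Dsin2 m; rewrite !expr2 => H; rewrite !mulrA -mulrDl H mul1r.
under eq_integral => o _.
  rewrite dE sinB (mulrC (sin ((a^T *m X o) 0 0))) (mulrC (cos ((a^T *m X o) 0 0))) -mulNr EFinD !EFinM.
  over.
rewrite integralD//; [|exact: integrableZl..].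
rewrite !integralZl// gc gs -!EFinM -EFinD; congr EFin.
by ring.
Qed.

Lemma gaussian_symmetric k (X : Omega -> 'cV[R]_k) mu M : mvec X ->
  gaussian_vec P X mu M -> symmetric_law (fun o => X o - mu).
Proof.
move=> mX gX; apply: symmetric_law_sin.
  by apply: mvecB => //; exact: mvec_cst.
by move=> a; have [] := gaussian_centered mX gX a.
Qed.

(** This is the derivative of sine at 0, taken along the steps x / (k + 1). *)
Lemma cvg_sinc_scale (x : R) :
  (k.+1%:R * sin (x / k.+1%:R)) @[k --> \oo] --> x.
Proof.
have [->|x0] := eqVneq x 0.
  by under eq_fun do rewrite mul0r sin0 mulr0; exact: cvg_cst.
have z0 : x / k.+1%:R @[k --> \oo] --> (0 : R)^'.
  have z1 : x / k.+1%:R @[k --> \oo] --> (0 : R).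
    rewrite -[X in _ --> X](mulr0 x); apply: cvgMr; exact: cvg_harmonic.
  move=> A /z1; rewrite /nbhs/= => -[K _ KA]; exists K => //= k Kk.
  by apply: KA => //; rewrite mulf_neq0// invr_eq0 pnatr_eq0.
have D : h^-1 * sin h @[h --> (0 : R)^'] --> (1 : R).
  have := @derivable_sin R 0; rewrite /derivable => /cvg_ex [l Hl].
  have l1 : l = 1.
    rewrite -(cvg_lim _ Hl)// -[LHS]/('D_1 sin 0).
    by rewrite (@derive_val _ _ _ _ _ _ _ (is_derive_sin 0)) cos0.
  move: Hl; rewrite l1; apply: cvg_trans; apply: near_eq_cvg; apply: nearW => h.
  by rewrite /= addr0 sin0 subr0 /GRing.scale/= mulr1.
have H : (x / k.+1%:R)^-1 * sin (x / k.+1%:R) @[k --> \oo] --> (1 : R).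
  by apply: cvg_comp z0 D.
rewrite -[X in _ --> X](mulr1 x).
have -> : (fun k => k.+1%:R * sin (x / k.+1%:R)) =
          (fun k => x * ((x / k.+1%:R)^-1 * sin (x / k.+1%:R))).
  by apply/funext => k; rewrite mulrA invf_div mulrCA mulfV// mulr1.
exact: cvgMr.
Qed.

(** By the half-angle formula 1 - cos y = 2 sin (y / 2)^2, the expression is a square to which the
    previous limit applies. *)
Lemma cvg_cos_scale (x : R) :
  (2 * k.+1%:R ^+ 2 * (1 - cos (x / k.+1%:R))) @[k --> \oo] --> x ^+ 2.
Proof.
have E k : 2 * k.+1%:R ^+ 2 * (1 - cos (x / k.+1%:R)) =
   (2 * (k.+1%:R * sin (x / 2 / k.+1%:R))) ^+ 2.
  have -> : x / k.+1%:R = x / 2 / k.+1%:R *+ 2 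
    by rewrite mulrAC -[RHS]mulr_natr divfK// pnatr_eq0.
  by rewrite cos_mulr2n cos2sin2; ring.
under eq_fun do rewrite E.
have -> : x ^+ 2 = (2 * (x / 2)) ^+ 2 by congr (_ ^+ 2); field.
by apply: cvgM; apply: cvgMr; exact: cvg_sinc_scale.
Qed.

(** Each approximant has mean 2 y^2 (1 - exp (- q / (2 y^2))) with q = [qf M a] and y = j + 1, which
    is at most q because exp x >= 1 + x. The inequality that Fatou provides is enough for square
    integrability. *)
Lemma gaussian_second_moment k (X : Omega -> 'cV[R]_k) mu M : mvec X ->
  gaussian_vec P X mu M -> forall a : 'cV[R]_k,
  (\int[P]_o (((a^T *m (X o - mu)) 0 0) ^+ 2)%:E <= (qf M a)%:E)%E.
Proof.
move=> mX gX a.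
pose U o : R := (a^T *m (X o - mu)) 0 0.
have mU : measurable_fun setT U.
  by apply: mvecM => //; apply: mvecB => //; exact: mvec_cst.
pose f k o : \bar R := (2 * k.+1%:R ^+ 2 * (1 - cos (U o / k.+1%:R)))%:E.
have mcosU j : measurable_fun setT (fun o => cos (U o / j.+1%:R)).
  apply: measurableT_comp; last exact: measurable_funM.
  by apply: continuous_measurable_fun; exact: continuous_cos.
have f0 j o : setT o -> (0 <= f j o)%E.
  by move=> _; rewrite lee_fin mulr_ge0// ?subr_ge0 ?cos_le1// mulr_ge0// sqr_ge0.
have mf j : measurable_fun setT (f j).
  apply/measurable_EFinP; apply: measurable_funM => //.
  exact: measurable_funB.
have EU : (\int[P]_o limn_einf (f^~ o) = \int[P]_o ((U o) ^+ 2)%:E)%E.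
  apply: eq_integral => o _; have [] // := @cvg_limn_einf_sup _ (f^~ o) (U o ^+ 2)%:E.
  by apply: cvg_EFin; [exact: nearW | exact: cvg_cos_scale].
have := fatou P measurableT mf f0; rewrite EU => H.
apply: (le_trans H); rewrite {H}.
have L j : (\int[P]_o f j o <= (qf M a)%:E)%E.
  (* Dividing U by j + 1 amounts to evaluating the characteristic function at a / (j + 1). *)
  have [C _] := gaussian_centered mX gX ((j.+1%:R)^-1 *: a).
  have qE : qf M (j.+1%:R^-1 *: a) = j.+1%:R^-1 ^+ 2 * qf M a.
    by rewrite /qf [(_ *: a)^T]linearZ/= -!scalemxAl -scalemxAr scalerA [LHS]mxE expr2.
  have ic : P.-integrable setT (fun o => (cos (U o / j.+1%:R))%:E).
    apply: measurable_bounded_integrable => //; first exact: fin_num_fun_lty.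
    by exists 1; split; [exact: num_real|move=> K K1 o _ /=; exact: le_trans (cos_max _) (ltW K1)].
  have i1 : P.-integrable setT (fun=> 1%:E) by exact: finite_measure_integrable_cst.
  rewrite /f; under eq_integral do rewrite EFinM EFinB.
  rewrite integralZl//; last exact: integrableB.
  rewrite integralB//.
  have -> : (\int[P]_o (cos (U o / j.+1%:R))%:E = (expR (- (qf M (j.+1%:R^-1 *: a) / 2)))%:E)%E.
    rewrite -C; apply: eq_integral => o _; congr (cos _)%:E.
    by rewrite [(_ *: a)^T]linearZ/= -scalemxAl [RHS]mxE mulrC.
  rewrite (_ : (\int[P]_o 1%:E)%E = 1%:E); last first.
    by rewrite integral_cst//= probability_setT mule1.
  rewrite -EFinB -EFinM lee_fin qE.
  set y := j.+1%:R.
  have y0 : y != 0 :> R by rewrite pnatr_eq0.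
  rewrite [leRHS](_ : qf M a = 2 * y ^+ 2 * (y^-1 ^+ 2 * qf M a / 2)); last by field.
  rewrite ler_wpM2l//; first by rewrite mulr_ge0// sqr_ge0.
  by rewrite lerBlDr -lerBlDl; exact: expR_ge1Dx.
rewrite limn_einf_lim; apply: lime_le; first exact: is_cvg_einfs.
apply: nearW => j; apply: le_trans (L j).
by apply: ereal_inf_lbound; exists j => /=.
Qed.

End GaussianSymmetry.

(** * Square integrability and independence *)

Section SquareIntegrable.
Context (R : realType) (d : measure_display) (Omega : measurableType d)
  (P : probability Omega R).

Definition sqi (f : Omega -> R) : Prop :=
  measurable_fun setT f /\ P.-integrable setT (fun o => (f o ^+ 2)%:E).

Lemma le_integrable_fin (f g : Omega -> R) : measurable_fun setT f ->
  (forall o, `|f o| <= g o) -> P.-integrable setT (fun o => (g o)%:E) ->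
  P.-integrable setT (fun o => (f o)%:E).
Proof.
move=> mf fg; apply: le_integrable => //; first exact/measurable_EFinP.
by move=> o _; rewrite !abse_EFin lee_fin (le_trans (fg o))// ler_norm.
Qed.

Lemma integrable_finD (f g : Omega -> R) :
  P.-integrable setT (fun o => (f o)%:E) -> P.-integrable setT (fun o => (g o)%:E) ->
  P.-integrable setT (fun o => (f o + g o)%:E).
Proof. by move=> If Ig; under eq_fun do rewrite EFinD; exact: integrableD. Qed.

Lemma integrable_finZ c (f : Omega -> R) :
  P.-integrable setT (fun o => (f o)%:E) ->
  P.-integrable setT (fun o => (c * f o)%:E).
Proof. by move=> If; under eq_fun do rewrite EFinM; exact: integrableZl. Qed.

Lemma integrable_fin_sum I (s : seq I) (f : I -> Omega -> R) :
  (forall i, P.-integrable setT (fun o => (f i o)%:E)) ->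
  P.-integrable setT (fun o => (\sum_(i <- s) f i o)%:E).
Proof.
move=> If; elim: s => [|i s IH].
  by under eq_fun do rewrite big_nil; exact: integrable0.
by under eq_fun do rewrite big_cons; exact: integrable_finD.
Qed.

Lemma sqi_mul f g : sqi f -> sqi g -> P.-integrable setT (fun o => (f o * g o)%:E).
Proof.
move=> [mf If] [mg Ig].
apply: (@le_integrable_fin _ (fun o => f o ^+ 2 + g o ^+ 2)).
- exact: measurable_funM.
- move=> o; rewrite normrM -(real_normK (num_real (f o))) -(real_normK (num_real (g o))).
  have : 0 <= (`|f o| - `|g o|) ^+ 2 by apply: sqr_ge0.
  have : 0 <= `|f o| * `|g o| by rewrite mulr_ge0.
  nra.
- exact: integrable_finD.
Qed.

Lemma sqiD f g : sqi f -> sqi g -> sqi (fun o => f o + g o).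
Proof.
move=> sf sg; have [[mf If] [mg Ig]] := (sf, sg).
split; first exact: measurable_funD.
have E : (fun o => ((f o + g o) ^+ 2)%:E) =
    (fun o => (f o ^+ 2 + (2 * (f o * g o) + g o ^+ 2))%:E).
  by apply/funext => o; congr EFin; ring.
by rewrite E; apply: integrable_finD => //; apply: integrable_finD => //;
  apply: integrable_finZ; exact: sqi_mul.
Qed.

Lemma sqiZ c f : sqi f -> sqi (fun o => c * f o).
Proof.
move=> [mf If]; split; first exact: measurable_funM.
by under eq_fun do rewrite exprMn; exact: integrable_finZ.
Qed.

Lemma sqi_cst c : sqi (fun=> c).
Proof.
by split; [exact: measurable_cst | exact: finite_measure_integrable_cst].
Qed.

Lemma sqi_sum I (s : seq I) (f : I -> Omega -> R) :
  (forall i, sqi (f i)) -> sqi (fun o => \sum_(i <- s) f i o).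
Proof.
move=> sf; elim: s => [|i s IH].
  by under eq_fun do rewrite big_nil; exact: sqi_cst.
by under eq_fun do rewrite big_cons; exact: sqiD.
Qed.

Lemma sqi_if (b : Omega -> bool) f g : measurable_fun setT b ->
  sqi f -> sqi g -> sqi (fun o => if b o then f o else g o).
Proof.
move=> mb [mf If] [mg Ig]; have m := measurable_fun_ifT mb mf mg.
split => //.
apply: (@le_integrable_fin _ (fun o => f o ^+ 2 + g o ^+ 2)).
- exact: measurable_funX.
- by move=> o; rewrite ger0_norm ?sqr_ge0//; case: (b o);
    rewrite ?lerDl ?lerDr sqr_ge0.
- exact: integrable_finD.
Qed.

Definition L2v k (X : Omega -> 'cV[R]_k) : Prop := forall i, sqi (fun o => X o i 0).

Lemma L2v_mvec k (X : Omega -> 'cV[R]_k) : L2v X -> mvec X.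
Proof. by move=> sX i; case: (sX i). Qed.

Lemma L2v_cst k (v : 'cV[R]_k) : L2v (fun=> v).
Proof. by move=> i; exact: sqi_cst. Qed.

Lemma L2vD k (X Y : Omega -> 'cV[R]_k) : L2v X -> L2v Y -> L2v (fun o => X o + Y o).
Proof. by move=> sX sY i; under eq_fun do rewrite mxE; exact: sqiD. Qed.

Lemma L2vM k l (M : 'M[R]_(k, l)) (X : Omega -> 'cV[R]_l) :
  L2v X -> L2v (fun o => M *m X o).
Proof.
move=> sX i; under eq_fun do rewrite mxE.
by apply: sqi_sum => j; exact: sqiZ.
Qed.

Lemma L2vN k (X : Omega -> 'cV[R]_k) : L2v X -> L2v (fun o => - X o).
Proof.
by move=> sX i; under eq_fun do rewrite mxE -mulN1r; exact: sqiZ.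
Qed.

Lemma L2vB k (X Y : Omega -> 'cV[R]_k) : L2v X -> L2v Y -> L2v (fun o => X o - Y o).
Proof. by move=> sX sY; apply: L2vD => //; exact: L2vN. Qed.

Lemma L2v_if k (b : Omega -> bool) (X Y : Omega -> 'cV[R]_k) :
  measurable_fun setT b -> L2v X -> L2v Y ->
  L2v (fun o => if b o then X o else Y o).
Proof.
move=> mb sX sY i.
under eq_fun do rewrite (fun_if (fun v : 'cV[R]_k => v i 0)).
exact: sqi_if.
Qed.

Lemma integrable_bilinear k l (M : 'M[R]_(k, l)) (X : Omega -> 'cV[R]_k)
    (Y : Omega -> 'cV[R]_l) : L2v X -> L2v Y ->
  P.-integrable setT (fun o => (((X o)^T *m M *m Y o) 0 0)%:E).
Proof.
move=> sX sY; under eq_fun do rewrite -mulmxA mxE.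
apply: integrable_fin_sum => j; under eq_fun do rewrite mxE.
by apply: sqi_mul => //; exact: L2vM.
Qed.

Lemma integrable_qf k (M : 'M[R]_k) (X : Omega -> 'cV[R]_k) :
  L2v X -> P.-integrable setT (fun o => (qf M (X o))%:E).
Proof. by move=> sX; exact: integrable_bilinear. Qed.

Lemma gaussian_L2v k (X : Omega -> 'cV[R]_k) mu M : mvec X ->
  gaussian_vec P X mu M -> L2v (fun o => X o - mu).
Proof.
move=> mX gX i.
have m : mvec (fun o => X o - mu) by apply: mvecB => //; exact: mvec_cst.
split; first exact: m.
apply/integrableP; split.
  by apply/measurable_EFinP; apply: measurable_funX; exact: m.
have := gaussian_second_moment mX gX (delta_mx i 0).
move=> /le_lt_trans /(_ (ltry _)); apply: le_lt_trans.
rewrite le_eqVlt; apply/orP; left; apply/eqP.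
apply: eq_integral => o _; rewrite gee0_abs ?lee_fin ?sqr_ge0//.
by rewrite trmx_delta -rowE [in RHS]mxE.
Qed.

(** The form in which symmetry is consumed: it equates integrals of nonnegative functions, here the
    positive and negative parts, and integrability makes their difference meaningful. *)
Lemma integral_odd_eq0 (h : Omega -> R) : P.-integrable setT (fun o => (h o)%:E) ->
  (\int[P]_o (Num.max (h o) 0)%:E = \int[P]_o (Num.max (- h o) 0)%:E)%E ->
  (\int[P]_o (h o)%:E = 0)%E.
Proof.
move=> Ih E; rewrite integralE.
have Ep : (fun o => (h o)%:E)^\+%E = (fun o => (Num.max (h o) 0)%:E).
  by apply/funext => o; rewrite funeposE EFin_max.
have En : (fun o => (h o)%:E)^\-%E = (fun o => (Num.max (- h o) 0)%:E).
  by apply/funext => o; rewrite funenegE EFin_max.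
have F := integrable_pos_fin_num measurableT Ih.
by rewrite Ep En -E -Ep subee.
Qed.

End SquareIntegrable.

Section Independence.
Context (R : realType) (d : measure_display) (Omega : measurableType d)
  (P : probability Omega R).

Definition independent_maps d1 d2 (T1 : measurableType d1) (T2 : measurableType d2)
    (f : Omega -> T1) (g : Omega -> T2) : Prop :=
  forall A B, measurable A -> measurable B ->
  P (f @^-1` A `&` g @^-1` B) = (P (f @^-1` A) * P (g @^-1` B))%E.

(** The joint law agrees with the product of the marginals on rectangles, hence everywhere; Tonelli
    then splits the integral. *)
Lemma independent_integral d1 d2 (T1 : measurableType d1) (T2 : measurableType d2)
    (f : Omega -> T1) (g : Omega -> T2) :
  measurable_fun setT f -> measurable_fun setT g -> independent_maps f g ->
  forall F : T1 * T2 -> \bar R, measurable_fun setT F -> (forall z, 0 <= F z)%E ->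
  (\int[P]_o F (f o, g o) = \int[P]_o \int[P]_p F (f o, g p))%E.
Proof.
move=> mf mg ind F mF F0.
pose f' : {mfun Omega >-> T1} := HB.pack f (isMeasurableFun.Build _ _ _ _ _ mf).
pose g' : {mfun Omega >-> T2} := HB.pack g (isMeasurableFun.Build _ _ _ _ _ mg).
pose m1 := distribution P f'; pose m2 := distribution P g'.
have mfg : measurable_fun setT (fun o => (f o, g o)) by exact: measurable_fun_pair.
transitivity (\int[pushforward P (fun o => (f o, g o))]_z F z)%E.
  by rewrite ge0_integral_pushforward.
transitivity (\int[m1 \x m2]_z F z)%E.
  apply: eq_measure_integral => X mX _; apply/esym.
  by apply: product_measure_unique => // A B mA mB; exact: ind.
rewrite fubini_tonelli1// /fubini_F.
rewrite ge0_integral_pushforward//; last 2 first.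
- exact: measurable_fun_fubini_tonelli_F.
- by move=> x _; exact: integral_ge0.
apply: eq_integral => o _ /=; rewrite ge0_integral_pushforward//.
by apply: measurableT_comp => //; exact: pair1_measurable.
Qed.

End Independence.

(** * Independence of one noise from a block of the others *)

Section TupleIndependence.
Context (R : realType) (d : measure_display) (Omega : measurableType d)
  (P : probability Omega R).

Definition tuple_box d' (T : measurableType d') q (C : 'I_q -> set T) : set (q.-tuple T) :=
  [set t | forall i, C i (tnth t i)].

Definition tuple_boxes d' (T : measurableType d') q : set (set (q.-tuple T)) :=
  [set X | exists2 C : 'I_q -> set T, (forall i, measurable (C i)) & X = tuple_box C].

Lemma measurable_tuple_box d' (T : measurableType d') q (C : 'I_q -> set T) :
  (forall i, measurable (C i)) -> measurable (tuple_box C).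
Proof.
move=> mC.
rewrite (_ : tuple_box C = \bigcap_(i in [set: 'I_q]) ((fun t : q.-tuple T => tnth t i) @^-1` C i)).
  apply: fin_bigcap_measurable => // i _.
  by rewrite -[X in measurable X]setTI; exact: measurable_tnth.
by apply/seteqP; split => t /= H i; [move=> _|]; exact: H.
Qed.

Lemma measurable_tuple_boxesE d' (T : measurableType d') q :
  @measurable _ (q.-tuple T) = <<s @tuple_boxes _ T q >>.
Proof.
apply/seteqP; split.
  apply: smallest_sub; first exact: smallest_sigma_algebra.
  move=> B; rewrite -bigcup_seq/= => -[j _] [C mC <-]; rewrite setTI.
  apply: sub_sigma_algebra; exists (fun i => if i == j then C else setT).
    by move=> i; case: (i == j).
  apply/seteqP; split => t /=.
    by move=> Ct i; case: eqP => // ->.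
  by move=> /(_ j); rewrite eqxx.
apply: smallest_sub; first exact: sigma_algebra_measurable.
by move=> _ [C mC ->]; exact: measurable_tuple_box.
Qed.

(** For fixed [B] both sides are finite measures in [A]. They agree on boxes by mutual independence,
    and boxes form a generating pi-system. *)
Lemma independent_tuple p q k (Y : 'I_p -> Omega -> 'cV[R]_k) (s : 'I_q -> 'I_p) j0 :
  mutually_independent P Y -> (forall j, mvec (Y j)) -> (forall i, s i != j0) ->
  independent_maps P (fun o => [tuple vtup (Y (s i) o) | i < q])
    (fun o => vtup (Y j0 o)).
Proof.
move=> ind mY sj0 A B mA mB.
set f := fun o => _; set g := fun o => vtup (Y j0 o).
have mf : measurable_fun setT f.
  apply/measurable_fun_tnthP => i /=.
  apply: (@eq_measurable_fun _ _ _ _ _ (fun o => vtup (Y (s i) o))).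
    by move=> o _ /=; rewrite tnth_mktuple.
  exact/mvec_vtup.
have mg : measurable_fun setT g by apply/mvec_vtup.
have mgB : measurable (g @^-1` B) by rewrite -[X in measurable X]setTI; exact: mg.
(* [s] may repeat indices, so component j has to satisfy every constraint [C i] with [s i = j]; the
   constraint [D] falls on [j0] alone. *)
pose A' (C : 'I_q -> set (k.-tuple R)) (D : set (k.-tuple R)) j : set (k.-tuple R) :=
  [set t | (j == j0 -> D t) /\ forall i, s i = j -> C i t].
have box C D : (forall i, measurable (C i)) -> measurable D ->
    P (f @^-1` tuple_box C `&` g @^-1` D) =
    (P (g @^-1` D) * \prod_(j < p | j != j0) P ((fun w => vtup (Y j w)) @^-1` A' C setT j))%E.
  move=> mC mD.
  have mA' j : measurable (A' C D j).
    rewrite (_ : A' C D j = (if j == j0 then D else setT) `&`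
        \bigcap_(i in [set i | s i = j]) C i).
      apply: measurableI; first by case: ifP.
      exact: fin_bigcap_measurable.
    apply/seteqP; split => t /= [H1 H2]; split => //.
    - by case: ifP => // jj0; exact: H1.
    - by move=> jj0; move: H1; rewrite jj0.
  have := ind _ mA'; rewrite (bigD1 j0)//=.
  rewrite (_ : \bigcap_(j in _) _ = f @^-1` tuple_box C `&` g @^-1` D); last first.
    apply/seteqP; split => o /=.
      move=> H; split; last by have [+ _] := H j0 I; apply.
      by move=> i; rewrite tnth_mktuple; have [_] := H (s i) I; apply.
    move=> [H1 H2] j _; split => [/eqP -> //|i <-].
    by have := H1 i; rewrite tnth_mktuple.
  move=> ->; congr (P _ * _)%E.
    apply/seteqP; split => o /= => [[+ _]|H]; first by apply.
    by split => // i si; have := sj0 i; rewrite si eqxx.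
  apply: eq_bigr => j /negPf jj0; congr (P _).
  by apply/seteqP; split => o /= -[H1 H2]; split => //; rewrite jj0.
pose c : {nonneg R} := NngNum (fine_ge0 (measure_ge0 P (g @^-1` B))).
have cE : (c%:num)%:E = P (g @^-1` B) by rewrite /= fineK// fin_num_measure.
pose m1 : {measure set (q.-tuple (k.-tuple R)) -> \bar R} :=
  pushforward (mrestr P mgB) f.
pose m2 : {measure set (q.-tuple (k.-tuple R)) -> \bar R} :=
  mscale c (pushforward P f).
have : m1 mf A = m2 mf A.
  apply: (@measure_unique _ _ _ (@tuple_boxes _ _ q) (fun=> setT)) => //.
  - exact: measurable_tuple_boxesE.
  - move=> _ _ [C mC ->] [D mD ->]; exists (fun i => C i `&` D i).
      by move=> i; exact: measurableI.
    apply/seteqP; split => t /= => [[H1 H2] i|H]; first by split.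
    by split => i; have [] := H i.
  - move=> _; exists (fun=> setT) => //.
    by apply/seteqP; split.
  - by rewrite bigcup_const//; exists 0%N.
  - move=> _ [C mC ->].
    rewrite /m1 /m2 /= /mscale /= /pushforward /= /mrestr /= cE box//.
    (* Taking [D = setT] identifies the product over the indices other than [j0] with the
       probability of the box. *)
    have := box C setT mC measurableT.
    rewrite preimage_setT setIT probability_setT mul1e => ->.
    by [].
  - move=> _; rewrite /m1 /= /pushforward /mrestr /=.
    by rewrite preimage_setT setTI ltey_eq fin_num_measure.
by rewrite /m1 /m2 /= /mscale /= /pushforward /= /mrestr /= cE muleC.
Qed.

End TupleIndependence.

(** * Quadratic forms and the Riccati recursion *)

Section QuadraticForms.
Variable R : realType.

Lemma qfN k (M : 'M[R]_k) v : qf M (- v) = qf M v.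
Proof. by rewrite /qf [(- v)^T]linearN/= mulmxN !mulNmx opprK. Qed.

Lemma qf0 k (M : 'M[R]_k) : qf M 0 = 0.
Proof. by rewrite /qf mulmx0 mxE. Qed.

Lemma qf_mx0 k (v : 'cV[R]_k) : qf 0 v = 0.
Proof. by rewrite /qf mulmx0 mul0mx mxE. Qed.

Lemma qfDl k (M1 M2 : 'M[R]_k) v : qf (M1 + M2) v = qf M1 v + qf M2 v.
Proof. by rewrite /qf mulmxDr mulmxDl mxE. Qed.

Lemma qfBl k (M1 M2 : 'M[R]_k) v : qf (M1 - M2) v = qf M1 v - qf M2 v.
Proof. by rewrite /qf mulmxBr mulmxBl mxE [X in _ + X]mxE. Qed.

Lemma bilC k l (M : 'M[R]_(k, l)) (a : 'cV[R]_k) (b : 'cV[R]_l) :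
  (a^T *m M *m b) 0 0 = (b^T *m M^T *m a) 0 0.
Proof.
by rewrite -[RHS](mxE trmx_key (fun i j => (b^T *m M^T *m a) j i)) -/(trmx _)
  !trmx_mul !trmxK mulmxA.
Qed.

Lemma qfD k (M : 'M[R]_k) a b : M^T = M ->
  qf M (a + b) = qf M a + qf M b + 2 * (a^T *m M *m b) 0 0.
Proof.
move=> sM; rewrite /qf [(a + b)^T]linearD/= !mulmxDl !mulmxDr.
rewrite [LHS]mxE [X in X + _]mxE [X in _ + X]mxE (bilC M b a) sM.
by ring.
Qed.

Lemma qfM k l (M : 'M[R]_k) (A : 'M[R]_(k, l)) v :
  qf M (A *m v) = qf (A^T *m M *m A) v.
Proof. by rewrite /qf trmx_mul !mulmxA. Qed.

Lemma pd_unitmx k (M : 'M[R]_k) : pd M -> M \in unitmx.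
Proof.
move=> [sM pM]; rewrite unitmxE unitfE; apply/negP => /det0P[v v0 vM].
have : 0 < qf M v^T.
  by apply: pM; apply: contra_neq v0 => v0; rewrite -[v]trmxK v0 trmx0.
by rewrite /qf trmxK vM mul0mx mxE ltxx.
Qed.

Lemma pd_psdD k l (S : 'M[R]_k) (B : 'M[R]_(k, l)) (M : 'M[R]_l) :
  psd S -> pd M -> pd (B^T *m S *m B + M).
Proof.
move=> [sS pS] [sM pM]; split.
  by rewrite linearD/= !trmx_mul trmxK sS sM mulmxA.
by move=> v v0; rewrite qfDl -qfM ltr_wpDl// ?pS// pM.
Qed.

(** Coercivity one coordinate at a time: it turns a finite control cost into square-integrable
    controls. With y = M^-1 e_i, coordinate i of u is the M-inner product of u and y, and the
    constant is the i-th diagonal entry of M^-1. *)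
Lemma pd_coord_le k (M : 'M[R]_k) : pd M ->
  forall i, exists c, forall u : 'cV[R]_k, u i 0 ^+ 2 <= c * qf M u.
Proof.
move=> pM i; have uM := pd_unitmx pM; have [sM qM] := pM.
pose e : 'cV[R]_k := delta_mx i 0; pose y := invmx M *m e.
have My : M *m y = e by rewrite mulmxA mulmxV// mul1mx.
exists (qf M y) => u.
have uy : (u^T *m M *m y) 0 0 = u i 0.
  by rewrite -mulmxA My -colE !mxE.
have y0 : 0 < qf M y.
  apply: qM; apply: contraTneq isT => y0.
  by move: My => /colP/(_ i); rewrite y0 mulmx0 !mxE !eqxx => /eqP; rewrite eq_sym oner_eq0.
have psM v : 0 <= qf M v.
  by have [->|v0] := eqVneq v 0; [rewrite qf0 | exact/ltW/qM].
(* Cauchy-Schwarz for the form [M], with the optimal multiple of [y]. *)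
pose t := u i 0 / qf M y.
have qZ c v : qf M (c *: v) = c ^+ 2 * qf M v.
  by rewrite /qf [(c *: v)^T]linearZ/= -!scalemxAl -scalemxAr scalerA [LHS]mxE expr2.
have mE : (u^T *m M *m - (t *: y)) 0 0 = - (t * u i 0).
  by rewrite mulmxN -scalemxAr mxE [X in - X]mxE uy.
have := psM (u - t *: y).
rewrite qfD// qfN qZ mE.
have -> : qf M u + t ^+ 2 * qf M y + 2 * - (t * u i 0) = qf M u - u i 0 ^+ 2 / qf M y.
  by rewrite /t; field; exact: lt0r_neq0.
by rewrite subr_ge0 ler_pdivrMr// mulrC.
Qed.

(** Both identities rest on Lam Lg = B^T S A, which matches the cross terms. The second holds for
    every [u], so it measures the loss of any control and not only that of the minimiser. *)
Lemma complete_square k l (S A Q : 'M[R]_k) (B : 'M[R]_(k, l)) (M : 'M[R]_l) x u :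
  S^T = S -> M^T = M -> B^T *m S *m B + M \in unitmx ->
  let Lam := B^T *m S *m B + M in
  let Lg := invmx Lam *m B^T *m S *m A in
  let G := A^T *m S *m B *m invmx Lam *m B^T *m S *m A in
  qf G x = qf Lam (Lg *m x) /\
  qf S (A *m x + B *m u) + qf Q x + qf M u =
  qf (Q + A^T *m S *m A - G) x + qf Lam (u + Lg *m x).
Proof.
move=> sS sM uL Lam Lg G.
have sL : Lam^T = Lam by rewrite /Lam linearD/= !trmx_mul trmxK sS sM mulmxA.
have LL : Lam *m Lg = B^T *m S *m A by rewrite /Lg !mulmxA mulmxV// mul1mx.
have GE : qf G x = qf Lam (Lg *m x).
  rewrite qfM; congr qf; rewrite -mulmxA LL /Lg !trmx_mul trmxK sS trmx_inv sL.
  by rewrite /G !mulmxA.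
split => //.
have E1 : (u^T *m Lam *m (Lg *m x)) 0 0 = (u^T *m (B^T *m S *m A) *m x) 0 0.
  by rewrite -LL !mulmxA.
have E2 : ((A *m x)^T *m S *m (B *m u)) 0 0 = (u^T *m (B^T *m S *m A) *m x) 0 0.
  by rewrite bilC sS trmx_mul !mulmxA.
rewrite qfD// [qf Lam (u + _)]qfD// E1 E2 qfBl qfDl -GE [qf Lam u]qfDl !qfM.
by ring.
Qed.

End QuadraticForms.

(** * The Riccati matrices and the one-step cost identity *)

Section Riccati.
Variables (R : realType) (n m N : nat)
  (A : nat -> 'M[R]_n) (B : nat -> 'M[R]_(n, m))
  (Q : nat -> 'M[R]_n) (Rc : nat -> 'M[R]_m).
Hypothesis psdQ : forall k, (k <= N.+1)%N -> psd (Q k).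
Hypothesis pdRc : forall k, (k <= N)%N -> pd (Rc k).
Local Notation Sk := (Defs.S N A B Q Rc).
Local Notation L := (Lgain N A B Q Rc).
Local Notation Gm := (Gam N A B Q Rc).

Definition Lam k := (B k)^T *m Sk k.+1 *m B k + Rc k.

Lemma S_rec k : (k <= N)%N ->
  Sk k = Q k + (A k)^T *m Sk k.+1 *m A k - Gam_of A B Rc k (Sk k.+1).
Proof. by move=> kN; rewrite /Defs.S subSn//= subKn// subSS. Qed.

(** The Riccati difference is not visibly nonnegative. At the control - L_i x the completed square
    vanishes, and the form of S_i at x becomes a sum of nonnegative costs. *)
Lemma psd_S k : (k <= N.+1)%N -> psd (Sk k).
Proof.
move=> kN; rewrite -(subKn kN); have : (N.+1 - k <= N.+1)%N by exact: leq_subr.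
elim: (N.+1 - k)%N => [_|j IH jN].
  by rewrite subn0 /Defs.S subnn; exact: psdQ.
rewrite subSS; have kN' : (N - j <= N)%N by exact: leq_subr.
have := IH (ltnW jN); rewrite subSn; last by rewrite -ltnS.
move: (N - j)%N kN' => i iN pS.
have [sS qS] := pS; have [sR qR] := pdRc iN; have [sQ qQ] := psdQ (leqW iN).
have pL : pd (Lam i) by apply: pd_psdD => //; exact: pdRc.
have uL := pd_unitmx pL; have sL := pL.1.
split.
  rewrite S_rec// /Gam_of -/(Lam i) !linearB/= !linearD/= !trmx_mul !trmxK.
  by rewrite trmx_inv sL sS sQ !mulmxA.
move=> x.
have [_ H] := @complete_square R n m _ (A i) (Q i) (B i) _ x (- (L i *m x)) sS sR uL.
have : qf (Sk i) x = qf (Sk i.+1) (A i *m x + B i *m (- (L i *m x))) + qf (Q i) x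
    + qf (Rc i) (- (L i *m x)).
  by rewrite H S_rec// addNr qf0 addr0.
move=> ->; rewrite !addr_ge0//.
have [->|v0] := eqVneq (- (L i *m x)) 0; first by rewrite qf0.
exact/ltW/qR.
Qed.

Lemma pd_Lam k : (k <= N)%N -> pd (Lam k).
Proof. by move=> kN; apply: pd_psdD; [exact: psd_S | exact: pdRc]. Qed.

Lemma psd_Lam k v : (k <= N)%N -> 0 <= qf (Lam k) v.
Proof.
move=> kN; have [->|v0] := eqVneq v 0; first by rewrite qf0.
by apply/ltW; apply: (pd_Lam kN).2.
Qed.

(** The weight Gamma_k in the trigger's problem is exactly the control loss caused by an estimation
    error. *)
Lemma qf_Gam k x : (k <= N)%N -> qf (Gm k) x = qf (Lam k) (L k *m x).
Proof.
move=> kN; have uL := pd_unitmx (pd_Lam kN).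
have [+ _] := @complete_square R n m _ (A k) (Q k) (B k) _ x 0
  (psd_S (kN : (k.+1 <= N.+1)%N)).1 (pdRc kN).1 uL.
by rewrite /Gam kN.
Qed.

Lemma qf_Gam_ge0 k x : 0 <= qf (Gm k) x.
Proof.
have [kN|kN] := leqP k N; first by rewrite qf_Gam// psd_Lam.
by rewrite /Gam leqNgt kN qf_mx0.
Qed.

Lemma trmx_Gam k : (Gm k)^T = Gm k.
Proof.
rewrite /Gam; case: ifP => kN; last by rewrite trmx0.
rewrite /Gam_of -/(Lam k) !trmx_mul !trmxK trmx_inv (pd_Lam kN).1.
by rewrite (psd_S (kN : (k.+1 <= N.+1)%N)).1 !mulmxA.
Qed.

(** Arranged to telescope: the S-terms cancel along a trajectory, and the last term is linear in the
    noise. *)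
Lemma riccati_step k x u w : (k <= N)%N ->
  qf (Q k) x + qf (Rc k) u =
  qf (Sk k) x - qf (Sk k.+1) (A k *m x + B k *m u + w)
  + qf (Lam k) (u + L k *m x) + qf (Sk k.+1) w
  + 2 * (w^T *m Sk k.+1 *m (A k *m x + B k *m u)) 0 0.
Proof.
move=> kN; have uL := pd_unitmx (pd_Lam kN).
have sS := (psd_S (kN : (k.+1 <= N.+1)%N)).1.
have [_] := @complete_square R n m _ (A k) (Q k) (B k) _ x u sS (pdRc kN).1 uL.
rewrite -[_ - _]/(Q k + (A k)^T *m Sk k.+1 *m A k - Gam_of A B Rc k (Sk k.+1)) -S_rec//.
rewrite -/(Lam k) -/(L k) => H.
rewrite [qf _ (_ + w)]qfD// (bilC _ w) sS.
move: H; set s := qf (Sk k.+1) _; set q := qf _ (_ + _ *m x) => H.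
lra.
Qed.

End Riccati.

(** * Closed-loop trajectories *)

(** A transmission: with a = A xhat, b = B u and c = A x, only the fresh noise is left in the
    error. *)
Lemma estimate_reset (V : zmodType) (a b c w : V) :
  c + b + w - (a + b + (c - a)) = w.
Proof.
by rewrite (addrC a) -(addrA b) (addrCA a) subrr addr0 (addrC b) (addrAC (c + b)) subrr add0r.
Qed.

Section Trajectories.
Variables (R : realType) (n m : nat)
  (A : nat -> 'M[R]_n) (B : nat -> 'M[R]_(n, m)).

Section closed_loop.
Variables (pi : trig_policy R n m) (mu : ctrl_policy R n m)
  (x0 : 'cV[R]_n) (w : nat -> 'cV[R]_n).

Definition xp k : 'cV[R]_n := nth 0 (hist A B pi mu x0 w k).1.1 k.
Definition dp k : bool :=
  pi k (hist A B pi mu x0 w k).1.1 (hist A B pi mu x0 w k).2.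
Definition up k : 'cV[R]_m :=
  mu k [seq (p.1, if p.1 then p.2 else 0) |
        p <- zip (hist A B pi mu x0 w k).1.2 (hist A B pi mu x0 w k).1.1].
Definition ip k : bool * 'cV[R]_n := (dp k, if dp k then xp k else 0).

Lemma histE k :
  hist A B pi mu x0 w k = (mkseq xp k.+1, mkseq dp k, mkseq up k).
Proof.
elim: k => // k IH.
have E : hist A B pi mu x0 w k.+1 = (rcons (mkseq xp k.+1)
    (A k *m xp k + B k *m up k + w k), rcons (mkseq dp k) (dp k),
    rcons (mkseq up k) (up k)).
  have lE : last x0 (mkseq xp k.+1) = xp k by rewrite mkseqS last_rcons.
  by rewrite -[xp k]lE /up /dp [LHS]/= IH.
have XS : xp k.+1 = A k *m xp k + B k *m up k + w k.
  by rewrite [LHS]/xp E nth_rcons size_mkseq ltnn eqxx.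
by rewrite E -XS -!mkseqS.
Qed.

(** There is one more state than there are triggers, and [zip] drops the surplus x_k: this is the
    one-step delay. *)
Lemma zip_infoE k : [seq (p.1, if p.1 then p.2 else 0) |
  p <- zip (mkseq dp k) (mkseq xp k.+1)] = mkseq ip k.
Proof.
apply: (@eq_from_nth _ (false, 0)).
  by rewrite size_map size_zip !size_mkseq; apply/minn_idPl.
move=> i; rewrite size_map size_zip !size_mkseq => iS.
have ik : (i < k)%N by apply: leq_trans iS _; exact: geq_minl.
rewrite (nth_map (false, 0)) ?size_zip ?size_mkseq// nth_zip_cond size_zip !size_mkseq iS.
by rewrite !nth_mkseq//= ltnS ltnW.
Qed.

Lemma xpS k : xp k.+1 = A k *m xp k + B k *m up k + w k.
Proof.
have lE : last x0 (mkseq xp k.+1) = xp k by rewrite mkseqS last_rcons.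
rewrite -lE /up histE {1}/xp [hist _ _ _ _ _ _ k.+1]/= histE.
by rewrite nth_rcons size_mkseq ltnn eqxx.
Qed.

Lemma dpE k : dp k = pi k (mkseq xp k.+1) (mkseq up k).
Proof. by rewrite /dp histE. Qed.

Lemma upE k : up k = mu k (mkseq ip k).
Proof. by rewrite /up histE /= zip_infoE. Qed.

Lemma costE N (Q : nat -> 'M[R]_n) (Rc : nat -> 'M[R]_m) (theta : nat -> R) :
  cost N A B Q Rc theta pi mu x0 w =
  qf (Q N.+1) (xp N.+1) + \sum_(k < N.+1) (qf (Q k) (xp k) + qf (Rc k) (up k)
     + (dp k)%:R * theta k).
Proof.
rewrite /cost histE nth_mkseq//; congr (_ + _); apply: eq_bigr => k _.
by rewrite !nth_mkseq// ltnS ltnW// ltnS.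
Qed.

End closed_loop.

(** Controls cancel from the error recursion, so the error is written as a function of the initial
    error, the noise and the triggers only. *)
Fixpoint err (e0 : 'cV[R]_n) (w : nat -> 'cV[R]_n) (dl : nat -> bool) k : 'cV[R]_n :=
  if k is k'.+1 then (if dl k' then 0 else A k' *m err e0 w dl k') + w k' else e0.

Lemma err_feedback_unique e0 w (rule : nat -> 'cV[R]_n -> bool) dl1 dl2 :
  (forall k, dl1 k = rule k (err e0 w dl1 k)) ->
  (forall k, dl2 k = rule k (err e0 w dl2 k)) ->
  forall k, err e0 w dl1 k = err e0 w dl2 k /\ dl1 k = dl2 k.
Proof.
move=> H1 H2; elim=> [|k [IHe IHd]]; first by rewrite H1 H2.
have E : err e0 w dl1 k.+1 = err e0 w dl2 k.+1 by rewrite /= IHe IHd.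
by rewrite H1 H2 E.
Qed.

Section estimates.
Variables (N : nat) (Q : nat -> 'M[R]_n) (Rc : nat -> 'M[R]_m) (m0 : 'cV[R]_n).
Local Notation mus := (mu_star N A B Q Rc m0).

Lemma eq_xhat_c (s s' : seq (bool * 'cV[R]_n)) t :
  (forall i, (i < t)%N -> nth (false, 0) s i = nth (false, 0) s' i) ->
  xhat_c N A B Q Rc m0 s t = xhat_c N A B Q Rc m0 s' t.
Proof.
elim: t => //= t IH H; rewrite IH ?H// => i it; exact: H (ltnW it).
Qed.

Section mu_star_loop.
Variables (pi : trig_policy R n m) (x0 : 'cV[R]_n) (w : nat -> 'cV[R]_n).
Local Notation x := (xp pi mus x0 w).
Local Notation u := (up pi mus x0 w).
Local Notation dl := (dp pi mus x0 w).

Definition xhc k := xhat_c N A B Q Rc m0 (mkseq (ip pi mus x0 w) k) k.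

Lemma up_mu_star k : u k = - (Lgain N A B Q Rc k *m xhc k).
Proof. by rewrite upE. Qed.

(** [xhat_c] has the control - L xhat built in; under [mu_star] this is the control actually
    applied. *)
Lemma xhcS k : xhc k.+1 = A k *m xhc k + B k *m u k
  + (if dl k then A k *m (x k - xhc k) else 0).
Proof.
have E : xhat_c N A B Q Rc m0 (mkseq (ip pi mus x0 w) k.+1) k = xhc k.
  by apply: eq_xhat_c => i ik; rewrite !nth_mkseq// ltnS ltnW.
rewrite {1}/xhc; rewrite [LHS]/=; rewrite E nth_mkseq//= up_mu_star.
by case: (dl k).
Qed.

Lemma err_mu_star k : x k - xhc k = err (x0 - m0) w dl k.
Proof.
elim: k => [//|k IH]; rewrite /= -IH xpS xhcS.
case: (dl k); last by rewrite addr0 mulmxBr addrAC opprD addrACA subrr addr0.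
by rewrite mulmxBr add0r estimate_reset.
Qed.

End mu_star_loop.

Section pi_star_loop.
Variables (theta : nat -> R) (d : measure_display) (Omega : measurableType d)
  (P : probability Omega R) (w' : nat -> Omega -> 'cV[R]_n).
Local Notation pis := (pi_star N A B Q Rc theta m0 P w').
Local Notation rule := (trig_rule N A B Q Rc theta P w').

Lemma xhat_eS xs us t : xhat_e N A B Q Rc theta m0 P w' xs us t.+1 =
  let xh := xhat_e N A B Q Rc theta m0 P w' xs us t in
  A t *m xh + B t *m nth 0 us t
  + (if rule t (nth 0 xs t - xh) then A t *m (nth 0 xs t - xh) else 0).
Proof. by []. Qed.

Lemma eq_xhat_e (s s' : seq 'cV[R]_n) (v v' : seq 'cV[R]_m) t :
  (forall i, (i < t)%N -> nth 0 s i = nth 0 s' i) ->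
  (forall i, (i < t)%N -> nth 0 v i = nth 0 v' i) ->
  xhat_e N A B Q Rc theta m0 P w' s v t = xhat_e N A B Q Rc theta m0 P w' s' v' t.
Proof.
elim: t => //= t IH H H'; rewrite IH ?H ?H'// => i it.
  exact: H (ltnW it).
exact: H' (ltnW it).
Qed.

Variables (mu : ctrl_policy R n m) (x0 : 'cV[R]_n) (w : nat -> 'cV[R]_n).
Local Notation x := (xp pis mu x0 w).
Local Notation u := (up pis mu x0 w).
Local Notation dl := (dp pis mu x0 w).

Definition xhe k :=
  xhat_e N A B Q Rc theta m0 P w' (mkseq x k.+1) (mkseq u k) k.

Lemma dp_pi_star k : dl k = rule k (x k - xhe k).
Proof. by rewrite dpE /pi_star nth_mkseq. Qed.

Lemma xheS k : xhe k.+1 = A k *m xhe k + B k *m u k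
  + (if dl k then A k *m (x k - xhe k) else 0).
Proof.
have E : xhat_e N A B Q Rc theta m0 P w' (mkseq x k.+2) (mkseq u k.+1) k = xhe k.
  apply: eq_xhat_e => i ik; first by rewrite !nth_mkseq// !ltnS ltnW// ltnW.
  by rewrite !nth_mkseq// !ltnS ltnW.
rewrite {1}/xhe xhat_eS E (nth_mkseq 0 u (ltnSn k)).
by rewrite (nth_mkseq 0 x (ltnW (ltnSn k.+1))) dp_pi_star.
Qed.

(** Valid for every [mu]: [xhat_e] reads the past controls actually applied, and the rule it
    recomputes reproduces the actual triggers. *)
Lemma err_pi_star k : x k - xhe k = err (x0 - m0) w dl k.
Proof.
elim: k => [//|k IH]; rewrite /= -IH xpS xheS.
case: (dl k); last by rewrite addr0 mulmxBr addrAC opprD addrACA subrr addr0.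
by rewrite mulmxBr add0r estimate_reset.
Qed.

Lemma dp_pi_star_err k : dl k = rule k (err (x0 - m0) w dl k).
Proof. by rewrite -err_pi_star dp_pi_star. Qed.

End pi_star_loop.
End estimates.

Section measurability.
Variables (N : nat) (pi : trig_policy R n m) (mu : ctrl_policy R n m).
Hypotheses (api : admissible_trig N pi) (amu : admissible_ctrl N mu).
Context (d : measure_display) (T : measurableType d).
Variables (x0 : T -> 'cV[R]_n) (w : nat -> T -> 'cV[R]_n).
Hypothesis mx0 : mvec x0.
Local Notation x := (fun k o => xp pi mu (x0 o) (w^~ o) k).
Local Notation u := (fun k o => up pi mu (x0 o) (w^~ o) k).
Local Notation dl := (fun k o => dp pi mu (x0 o) (w^~ o) k).
Local Notation inf := (fun k o => ip pi mu (x0 o) (w^~ o) k).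

Lemma mkseq_tuple (U V : Type) (g : U -> V) (f : nat -> U) k :
  [seq g x | x <- [tuple f i | i < k]] = mkseq (fun i => g (f i)) k.
Proof.
rewrite /= -map_comp /mkseq -val_enum_ord -map_comp.
exact: eq_map.
Qed.

Definition info_tuple k o : k.-tuple (bool * n.-tuple R) :=
  [tuple ((inf i o).1, vtup (inf i o).2) | i < k].

Lemma info_tupleE k o :
  [seq (p.1, tupv p.2) | p <- info_tuple k o] = mkseq (inf^~ o) k.
Proof.
rewrite (mkseq_tuple (fun p => (p.1, tupv p.2)) (fun i => ((inf i o).1, vtup (inf i o).2))); apply: eq_map => i /=.
by rewrite vtupK.
Qed.

Lemma measurable_info_tuple k :
  (forall j, (j < k)%N -> mvec (x j) /\ measurable_fun setT (dl j)) ->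
  measurable_fun setT (info_tuple k).
Proof.
move=> H; apply/measurable_fun_tnthP => i /=.
apply: (@eq_measurable_fun _ _ _ _ _ (fun o => ((inf i o).1, vtup (inf i o).2))).
  by move=> o _ /=; rewrite tnth_mktuple.
have [mx md] := H i (ltn_ord i).
apply: measurable_fun_pair => //.
by apply/mvec_vtup; apply: mvec_if => //; exact: mvec_cst.
Qed.

(** The sample space is arbitrary and only the noises before time k are assumed measurable, so the
    same statement gives measurability on [Omega] and adaptedness on [past k]. *)
Lemma measurable_loop k : (k <= N)%N -> (forall t, (t < k)%N -> mvec (w t)) ->
  [/\ mvec (x k), measurable_fun setT (dl k) & mvec (u k)].
Proof.
elim/ltn_ind: k => k IH kN mw.
have H j : (j < k)%N -> [/\ mvec (x j), measurable_fun setT (dl j) & mvec (u j)].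
  by move=> jk; apply: IH => // [|t tj]; [exact: leq_trans (ltnW jk) kN|apply: mw; exact: ltn_trans jk].
have mxk : mvec (x k).
  case: k => [|k] in IH kN mw H *; first exact: mx0.
  have [mxk _ muk] := H k (ltnSn k).
  apply: (@eq_ind _ _ (@mvec R d T n) _ (fun o => xp pi mu (x0 o) (w^~ o) k.+1)); last first.
    apply/esym/funext => o; exact: xpS.
  by apply: mvecD; [apply: mvecD; exact: mvecM|exact: mw].
split => //.
- pose h o : (k.+1.-tuple (n.-tuple R) * k.-tuple (m.-tuple R))%type :=
    ([tuple vtup (x i o) | i < k.+1], [tuple vtup (u i o) | i < k]).
  have mh : measurable_fun setT h.
    apply: measurable_fun_pair; apply/measurable_fun_tnthP => i /=.
      apply: (@eq_measurable_fun _ _ _ _ _ (fun o => vtup (x i o))).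
        by move=> o _ /=; rewrite tnth_mktuple.
      apply/mvec_vtup.
      have := ltn_ord i; rewrite ltnS leq_eqVlt => /orP[/eqP ->//|ik].
      by have [] := H i ik.
    apply: (@eq_measurable_fun _ _ _ _ _ (fun o => vtup (u i o))).
      by move=> o _ /=; rewrite tnth_mktuple.
    by apply/mvec_vtup; have [] := H i (ltn_ord i).
  apply: eq_measurable_fun (measurableT_comp (api kN) mh) => o _.
  rewrite dpE [LHS]/= (mkseq_tuple (@tupv R n) (fun i => vtup (x i o)))
    (mkseq_tuple (@tupv R m) (fun i => vtup (u i o))).
  by congr (pi _ _ _); apply: eq_map => i; rewrite vtupK.
- have mh : measurable_fun setT (info_tuple k).
    by apply: measurable_info_tuple => j /H[].
  move=> i; apply: eq_measurable_fun (measurableT_comp (amu kN i) mh) => o _.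
  by rewrite upE [LHS]/= info_tupleE.
Qed.

Lemma measurable_err k : (k <= N.+1)%N -> (forall t, (t < k)%N -> mvec (w t)) ->
  forall m0, mvec (fun o => err (x0 o - m0) (w^~ o) (dl^~ o) k).
Proof.
move=> kN mw m0; elim: k kN mw => [_ _|k IH kN mw] /=.
  by apply: mvecB => //; exact: mvec_cst.
apply: mvecD; last exact: mw.
have [_ md _] : [/\ mvec (x k), measurable_fun setT (dl k) & mvec (u k)].
  by apply: measurable_loop => // t tk; exact/mw/ltnW.
apply: mvec_if => //.
by apply: mvecM; apply: IH; [exact: ltnW|move=> t tk; exact/mw/ltnW].
Qed.

End measurability.
End Trajectories.

(** * Value function and value of information *)

Section ValueFunction.
Variables (R : realType) (n m N : nat)
  (A : nat -> 'M[R]_n) (B : nat -> 'M[R]_(n, m))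
  (Q : nat -> 'M[R]_n) (Rc : nat -> 'M[R]_m) (theta : nat -> R).
Context (d : measure_display) (Omega : measurableType d) (P : probability Omega R).
Variable w : nat -> Omega -> 'cV[R]_n.
Hypothesis psdQ : forall k, (k <= N.+1)%N -> psd (Q k).
Hypothesis pdRc : forall k, (k <= N)%N -> pd (Rc k).
Hypothesis theta0 : forall k, (k <= N)%N -> 0 <= theta k.
Hypothesis L2w : forall k, (k <= N)%N -> L2v P (w k).
Hypothesis symw : forall k, (k <= N)%N -> symmetric_law P (w k).
Local Notation G := (Gam N A B Q Rc).
Local Notation V := (Ve N A B Q Rc theta P w).
Local Notation rule := (trig_rule N A B Q Rc theta P w).

Let mw k : (k <= N)%N -> mvec (w k).
Proof. by move=> kN; apply: L2v_mvec; exact: L2w. Qed.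

(** [y] is the error after the decision: A_k e_k in case of silence, 0 after a transmission. *)
Definition cost_to_go k (y : 'cV[R]_n) : \bar R :=
  (\int[P]_o ((qf (G k.+1) (y + w k o)%R)%:E + V k.+1 (y + w k o)%R))%E.

Lemma Ve_last e : V N.+1 e = 0%E.
Proof. by rewrite /Ve subnn. Qed.

Lemma Ve_rec k e : (k <= N)%N ->
  V k e = Order.min (cost_to_go k (A k *m e)) ((theta k)%:E + cost_to_go k 0)%E.
Proof.
move=> kN; rewrite {1}/Ve subSn//= subKn// /cost_to_go /Ve subSS.
congr (Order.min _ (_ + _))%E; apply: eq_integral => o _.
by rewrite add0r.
Qed.

Definition regular_value (F : 'cV[R]_n -> \bar R) : Prop :=
  [/\ mcv F, (forall v, 0 <= F v)%E, (exists c : R, forall v, F v <= c%:E)%E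
    & forall v, F (- v) = F v].

Lemma measurable_stage k d' (T : measurableType d') (X : T -> 'cV[R]_n) :
  mcv (V k.+1) -> mvec X ->
  measurable_fun setT (fun t => ((qf (G k.+1) (X t))%:E + V k.+1 (X t))%E).
Proof.
move=> mV mX; apply: emeasurable_funD; last exact: mcv_comp.
by apply/measurable_EFinP; exact: measurable_qf.
Qed.

Lemma stage_ge0 k v : (forall v, 0 <= V k.+1 v)%E ->
  (0 <= (qf (G k.+1) v)%:E + V k.+1 v)%E.
Proof. by move=> V0; rewrite adde_ge0// lee_fin qf_Gam_ge0. Qed.

Lemma cost_to_go_ge0 k y : (forall v, 0 <= V k.+1 v)%E -> (0 <= cost_to_go k y)%E.
Proof. by move=> V0; apply: integral_ge0 => o _; exact: stage_ge0. Qed.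

Lemma mcv_cost_to_go k : (k <= N)%N -> mcv (V k.+1) -> (forall v, 0 <= V k.+1 v)%E ->
  mcv (cost_to_go k).
Proof.
move=> kN mV V0.
pose f (z : n.-tuple R * Omega) : \bar R :=
  ((qf (G k.+1) (tupv z.1 + w k z.2)%R)%:E + V k.+1 (tupv z.1 + w k z.2)%R)%E.
have mf : measurable_fun setT f.
  apply: measurable_stage => //; apply: mvecD.
    by apply: (mvec_comp (X := @tupv R n)) => //; exact: mvec_tupv.
  by apply: (mvec_comp (X := w k)) => //; exact: mw.
apply: (@measurable_fun_fubini_tonelli_F _ _ _ _ _ P f) => //.
by move=> z; exact: stage_ge0.
Qed.

(** The value is bounded although the stage cost is quadratic, because transmitting costs the same
    whatever the error. Evenness passes from V_(k+1) to V_k through the symmetry of w_k. *)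
Lemma regular_V k : (k <= N.+1)%N -> regular_value (V k).
Proof.
move=> kN; rewrite -(subKn kN); have : (N.+1 - k <= N.+1)%N by exact: leq_subr.
elim: (N.+1 - k)%N => [_|j IH jN].
  rewrite subn0; split.
  - by rewrite /mcv; under eq_fun do rewrite Ve_last; exact: measurable_cst.
  - by move=> v; rewrite Ve_last.
  - by exists 0 => v; rewrite Ve_last.
  - by move=> v; rewrite !Ve_last.
rewrite subSS; have kN' : (N - j <= N)%N by exact: leq_subr.
have := IH (ltnW jN); rewrite subSn; last by rewrite -ltnS.
move: (N - j)%N kN' => i iN [mV V0 [c Vc] eV].
have Vi : V i = (fun e => Order.min (cost_to_go i (A i *m e))
    ((theta i)%:E + cost_to_go i 0)%E).
  by apply/funext => e; exact: Ve_rec.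
have mC := mcv_cost_to_go iN mV V0.
have C0 y := cost_to_go_ge0 y V0.
have th0 : (0 <= (theta i)%:E)%E by rewrite lee_fin theta0.
split.
- rewrite Vi; apply: measurable_mine; last exact: measurable_cst.
  by apply: mcv_comp => //; apply: mvecM; exact: mvec_tupv.
- by move=> v; rewrite Vi le_min C0 adde_ge0.
- have L : (cost_to_go i 0 < +oo)%E.
    have Iq := integrable_qf (G i.+1) (L2w iN).
    apply: (@le_lt_trans _ _ (\int[P]_o ((qf (G i.+1) (w i o))%:E + c%:E))%E).
      apply: ge0_le_integral => //.
      + by move=> o _; rewrite stage_ge0.
      + apply: measurable_stage => //; apply: mvecD; [exact: mvec_cst|exact: mw].
      + apply: emeasurable_funD => //; apply/measurable_EFinP.
        by apply: measurable_qf; exact: mw.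
      + by move=> o _; rewrite add0r leeD2l.
    rewrite integralD//; last exact: finite_measure_integrable_cst.
    apply: lte_add_pinfty; apply: integrable_lty => //.
    exact: finite_measure_integrable_cst.
  exists (fine ((theta i)%:E + cost_to_go i 0)%E) => v; rewrite fineK.
    by rewrite Vi ge_min lexx orbT.
  rewrite ge0_fin_numE; last exact: adde_ge0.
  by apply: lte_add_pinfty; rewrite ?ltry.
- move=> v; rewrite !Vi; congr Order.min.
  have mg y : mcv (fun v : 'cV[R]_n => ((qf (G i.+1) (y + v)%R)%:E + V i.+1 (y + v)%R)%E).
    rewrite /mcv; apply: measurable_stage => //.
    by apply: mvecD; [exact: mvec_cst | exact: mvec_tupv].
  have g0 y u : (0 <= (qf (G i.+1) (y + u)%R)%:E + V i.+1 (y + u)%R)%E.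
    exact: stage_ge0.
  rewrite /cost_to_go (symw iN (mg (A i *m - v)) (g0 _)).
  apply: eq_integral => o _.
  by rewrite mulmxN -opprD qfN eV.
Qed.

Lemma mcv_V k : (k <= N.+1)%N -> mcv (V k).
Proof. by case/regular_V. Qed.

Lemma V_ge0 k v : (k <= N.+1)%N -> (0 <= V k v)%E.
Proof. by case/regular_V. Qed.

Lemma V_even k v : (k <= N.+1)%N -> V k (- v) = V k v.
Proof. by case/regular_V. Qed.

Lemma integral_V_fin_num k (X : Omega -> 'cV[R]_n) : (k <= N.+1)%N -> mvec X ->
  (\int[P]_o V k (X o))%E \is a fin_num.
Proof.
move=> kN mX; have [mV V0 [c Vc] _] := regular_V kN.
rewrite ge0_fin_numE ?integral_ge0//.
apply: (@le_lt_trans _ _ (\int[P]_o c%:E)%E).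
  by apply: ge0_le_integral => //; exact: mcv_comp.
by rewrite integral_cst//= probability_setT mule1 ltry.
Qed.

Lemma integral_linear_eq0 k (a : 'rV[R]_n) : (k <= N)%N ->
  (\int[P]_o ((a *m w k o) 0 0)%:E = 0)%E.
Proof.
move=> kN; apply: integral_odd_eq0.
  have := sqi_mul (L2vM a (L2w kN) 0) (sqi_cst P 1).
  by under eq_fun do rewrite mulr1.
pose F (v : 'cV[R]_n) := (Num.max ((a *m v) 0 0) 0)%:E.
have -> : (\int[P]_o (Num.max (- (a *m w k o) 0 0) 0)%:E = \int[P]_o F (- w k o)%R)%E.
  by apply: eq_integral => o _; rewrite /F mulmxN [in RHS]mxE.
apply: (symw kN) => [|v]; last by rewrite lee_fin le_max lexx orbT.
apply/measurable_EFinP; apply: measurable_maxr => //.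
by apply: mvecM; exact: mvec_tupv.
Qed.

(** The cross term between [y] and the noise has mean zero, which isolates the summands that make up
    [VoI]. *)
Lemma cost_to_goE k y : (k <= N)%N -> cost_to_go k y =
  ((qf (G k.+1) y)%:E + \int[P]_o (qf (G k.+1) (w k o))%:E
   + \int[P]_o V k.+1 (y + w k o)%R)%E.
Proof.
move=> kN; have kN' : (k.+1 <= N.+1)%N by [].
have mX : mvec (fun o => y + w k o) by apply: mvecD; [exact: mvec_cst|exact: mw].
have lX : L2v P (fun o => y + w k o) by apply: L2vD; [exact: L2v_cst|exact: L2w].
rewrite /cost_to_go ge0_integralD//; first last.
- by apply: mcv_comp => //; exact: mcv_V.
- by move=> o _; exact: V_ge0.
- by apply/measurable_EFinP; exact: measurable_qf.
- by move=> o _; rewrite lee_fin qf_Gam_ge0.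
congr (_ + _)%E.
under eq_integral do rewrite qfD ?trmx_Gam// EFinD EFinD EFinM.
have Iq := integrable_qf (G k.+1) (L2w kN).
have Ib : P.-integrable setT (fun o => ((y^T *m G k.+1 *m w k o) 0 0)%:E).
  by apply: (@integrable_bilinear _ _ _ P _ _ (G k.+1) (fun=> y)); [exact: L2v_cst|exact: L2w].
have Ic : P.-integrable setT (fun=> (qf (G k.+1) y)%:E) by exact: finite_measure_integrable_cst.
rewrite integralD//; [|exact: integrableD|exact: integrableZl].
rewrite integralD// integralZl// integral_linear_eq0// mule0 adde0.
by rewrite integral_cst//= probability_setT mule1.
Qed.

(** The sign of [VoI] compares the two branches of the minimum. Bounded values make every integral
    finite, so the inequality can be rearranged over the reals and the common noise term cancels. *)
Lemma trig_ruleE k e : (k <= N)%N ->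
  rule k e = ((theta k)%:E + cost_to_go k 0 <= cost_to_go k (A k *m e))%E.
Proof.
move=> kN; rewrite /trig_rule /VoI /varrho !cost_to_goE// qf0 add0e.
have -> : (\int[P]_o V k.+1 (0 + w k o)%R = \int[P]_o V k.+1 (w k o))%E.
  by apply: eq_integral => o _; rewrite add0r.
have mX y : mvec (fun o => y + w k o) by apply: mvecD; [exact: mvec_cst|exact: mw].
have f1 := integral_V_fin_num (kN : (k.+1 <= N.+1)%N) (mX (A k *m e)).
have f2 := integral_V_fin_num (kN : (k.+1 <= N.+1)%N) (mw kN).
have f3 := integrable_fin_num measurableT (integrable_qf (G k.+1) (L2w kN)).
rewrite -(fineK f1) -(fineK f2) -(fineK f3).
rewrite -EFinB -!EFinD !lee_fin.
set a := fine _; set b := fine _; set c := fine _; set q := qf _ _; set t := theta k.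
by apply/idP/idP => H; lra.
Qed.

Lemma rule_min k e : (k <= N)%N -> V k e =
  if rule k e then ((theta k)%:E + cost_to_go k 0)%E else cost_to_go k (A k *m e).
Proof.
move=> kN; rewrite Ve_rec// trig_ruleE//.
case: ifP => H; first by apply/min_idPr.
by apply/min_idPl; rewrite leNgt; apply/negP => /ltW; rewrite H.
Qed.

Lemma measurable_rule k d' (T : measurableType d') (X : T -> 'cV[R]_n) :
  (k <= N)%N -> mvec X -> measurable_fun setT (fun t => rule k (X t)).
Proof.
move=> kN mX; apply: (measurable_fun_bool true).
have mC : measurable_fun setT (fun t => cost_to_go k (A k *m X t)).
  apply: mcv_comp; last exact: mvecM.
  by apply: mcv_cost_to_go => // [|v]; [exact: mcv_V|exact: V_ge0].
have := emeasurable_fun_c_infty measurableT mC ((theta k)%:E + cost_to_go k 0)%E.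
by congr measurable; apply/seteqP; split => t /=; rewrite trig_ruleE// => -[].
Qed.

Lemma VoI_even k e : (k <= N)%N ->
  VoI N A B Q Rc theta P w k (- e) = VoI N A B Q Rc theta P w k e.
Proof.
move=> kN; rewrite /VoI /varrho mulmxN qfN; congr (_ + (_ - _))%E.
have mg y : mcv (fun v => V k.+1 (y + v)).
  apply: (mcv_comp (F := V k.+1) (X := fun t => y + tupv t)); first exact: mcv_V.
  by apply: mvecD; [exact: mvec_cst|exact: mvec_tupv].
rewrite (symw kN (mg _)); last by move=> v; exact: V_ge0.
by apply: eq_integral => o _; rewrite -opprD V_even.
Qed.

End ValueFunction.

(** * The Nash equilibrium *)

Section Filtration.
Variables (R : realType) (n N : nat).
Context (d : measure_display) (Omega : measurableType d) (P : probability Omega R).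
Variables (x0 : Omega -> 'cV[R]_n) (w : nat -> Omega -> 'cV[R]_n).
Hypothesis mx0 : mvec x0.
Hypothesis mw : forall k, (k <= N)%N -> mvec (w k).
Hypothesis symw : forall k, (k <= N)%N -> symmetric_law P (w k).
Local Notation noise := (fun j : 'I_N.+2 => if val j is j'.+1 then w j' else x0).
Hypothesis ind : mutually_independent P noise.

Definition past_noise k (o : Omega) : k.+1.-tuple (n.-tuple R) :=
  [tuple vtup (noise (inord i) o) | i < k.+1].

(* Omega with the sigma-algebra generated by [x0, w 0, ..., w (k - 1)]. *)
Definition past k := g_sigma_algebra_preimageType (past_noise k).

Lemma measurable_past_noise k :
  measurable_fun [set: past k] (past_noise k : past k -> _).
Proof. by move=> _ C mC; exists C => //; rewrite !setTI. Qed.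

Lemma mvec_past_noise k i : (i <= k)%N ->
  mvec (noise (inord i) : past k -> 'cV[R]_n).
Proof.
move=> ik; apply/mvec_vtup.
have /measurable_fun_tnthP/(_ (Ordinal (ik : (i < k.+1)%N))) := @measurable_past_noise k.
apply: eq_measurable_fun => o _ /=.
by rewrite /past_noise tnth_mktuple.
Qed.

Lemma past_x0 k : mvec (x0 : past k -> 'cV[R]_n).
Proof. by have := @mvec_past_noise k 0 (leq0n k); rewrite /= inordK. Qed.

Lemma past_w k t : (k <= N)%N -> (t < k)%N -> mvec (w t : past k -> 'cV[R]_n).
Proof.
move=> kN tk; have := mvec_past_noise tk; rewrite /= inordK//.
by rewrite !ltnS (leq_trans (ltnW tk)).
Qed.

Lemma mvec_noise j : mvec (noise j).
Proof.
case: j => -[|j] jN /=; first exact: mx0.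
exact: mw.
Qed.

Lemma independent_past k : (k <= N)%N ->
  independent_maps P (id : Omega -> past k) (fun o => vtup (w k o)).
Proof.
move=> kN _ B [C mC <-] mB; rewrite setTI.
(* [x0] has index 0, so [w k] is noise number k + 1, outside the block 0..k that generates
   [past k]. *)
have si (i : 'I_k.+1) : inord i != inord k.+1 :> 'I_N.+2.
  apply/eqP => /(congr1 val) /=; rewrite !inordK//.
    by move=> E; have := ltn_ord i; rewrite E ltnn.
  by rewrite !ltnS (leq_trans (ltnW (ltn_ord i)))// ltnW.
have H := @independent_tuple R d Omega P N.+2 k.+1 n noise
  (fun i => inord i) (inord k.+1) ind mvec_noise si.
have := H C B mC mB.
by rewrite /= inordK.
Qed.

(** The substitute for conditional expectation given x_0, w_0, ..., w_(k-1). *)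
Lemma past_integral k : (k <= N)%N ->
  forall F : Omega -> 'cV[R]_n -> \bar R,
  measurable_fun [set: past k * n.-tuple R] (fun z => F z.1 (tupv z.2)) ->
  (forall o v, 0 <= F o v)%E ->
  (\int[P]_o F o (w k o) = \int[P]_o \int[P]_p F o (w k p))%E.
Proof.
move=> kN F mF F0.
have mid : measurable_fun [set: Omega] (id : Omega -> past k).
  move=> _ _ [C mC <-]; rewrite setTI setTI -[X in measurable X]setTI.
  suff mp : measurable_fun [set: Omega] (past_noise k) by exact: mp.
  apply/measurable_fun_tnthP => i /=.
  apply: (@eq_measurable_fun _ _ _ _ _ (fun o => vtup (noise (inord i) o))).
    by move=> o _ /=; rewrite tnth_mktuple.
  apply/mvec_vtup; exact: mvec_noise.
have mv : measurable_fun [set: Omega] (fun o => vtup (w k o)).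
  by apply/mvec_vtup; exact: mw.
have := independent_integral mid mv (independent_past kN) mF (fun z => F0 _ _).
under eq_integral do rewrite /= vtupK.
under [X in _ = X -> _]eq_integral do under eq_integral do rewrite /= vtupK.
by [].
Qed.

Lemma past_flip k : (k <= N)%N ->
  forall F : Omega -> 'cV[R]_n -> \bar R,
  measurable_fun [set: past k * n.-tuple R] (fun z => F z.1 (tupv z.2)) ->
  (forall o v, 0 <= F o v)%E ->
  (\int[P]_o F o (w k o) = \int[P]_o F o (- w k o)%R)%E.
Proof.
move=> kN F mF F0.
rewrite (past_integral kN mF F0).
have mF' : measurable_fun [set: past k * n.-tuple R] (fun z => F z.1 (- tupv z.2)).
  pose h (z : past k * n.-tuple R) : past k * n.-tuple R := (z.1, vtup (- tupv z.2)).
  have mh : measurable_fun setT h.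
    apply: measurable_fun_pair => //; apply/mvec_vtup; apply: mvecN.
    by apply: (mvec_comp (X := @tupv R n)) => //; exact: mvec_tupv.
  apply: eq_measurable_fun (measurableT_comp mF mh) => z _ /=.
  by rewrite vtupK.
rewrite (past_integral kN (F := fun o v => F o (- v)) mF')//.
apply: eq_integral => o _; apply: (symw kN) => //.
by apply: (measurable_fun_pair2 (f := fun z : past k * n.-tuple R => F z.1 (tupv z.2))).
Qed.

Lemma past_orthogonal k l (M : 'M[R]_(n, l)) (Y : Omega -> 'cV[R]_l) : (k <= N)%N ->
  mvec (Y : past k -> _) ->
  P.-integrable setT (fun o => (((w k o)^T *m M *m Y o) 0 0)%:E) ->
  (\int[P]_o (((w k o)^T *m M *m Y o) 0 0)%:E = 0)%E.
Proof.
move=> kN mY I; apply: integral_odd_eq0 => //.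
pose F (o : Omega) (v : 'cV[R]_n) := (Num.max ((v^T *m M *m Y o) 0 0) 0)%:E.
rewrite [RHS](_ : _ = \int[P]_o F o (- w k o)%R)%E; last first.
  apply: eq_integral => o _; rewrite /F.
  by rewrite [(- w k o)^T]linearN/= !mulNmx [in RHS]mxE.
apply: (past_flip kN (F := F)) => [|o v]; last by rewrite lee_fin le_max lexx orbT.
apply/measurable_EFinP; apply: measurable_maxr => //.
apply: measurable_bilinear.
  by apply: (mvec_comp (X := @tupv R n)) => //; exact: mvec_tupv.
by apply: (mvec_comp (X := Y : past k -> _)).
Qed.

End Filtration.

Lemma nth_map_tnth (U V : Type) (f : U -> V) (v : V) k (t : k.-tuple U) i
    (ik : (i < k)%N) : nth v [seq f y | y <- t] i = f (tnth t (Ordinal ik)).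
Proof. by rewrite -tnth_map (tnth_nth v). Qed.

Lemma measurable_rcons_tuple d d' (T : measurableType d) (U : measurableType d') k
    (f : T -> k.-tuple U) (a : T -> U) :
  measurable_fun setT f -> measurable_fun setT a ->
  measurable_fun setT (fun t => [tuple of rcons (f t) (a t)]).
Proof.
move=> /measurable_fun_tnthP mf ma; apply/measurable_fun_tnthP => i /=.
have [ik|ki] := ltnP i k.
  apply: eq_measurable_fun (mf (Ordinal ik)) => t _ /=.
  by rewrite (tnth_nth (a t)) [in RHS](tnth_nth (a t)) /= nth_rcons size_tuple ik.
apply: eq_measurable_fun ma => t _ /=.
have ik : nat_of_ord i = k by apply/eqP; rewrite eqn_leq ki -ltnS ltn_ord.
by rewrite [in RHS](tnth_nth (a t)) /= nth_rcons size_tuple ik ltnn eqxx.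
Qed.

Section Game.
Variables (R : realType) (n m N : nat)
  (A : nat -> 'M[R]_n) (B : nat -> 'M[R]_(n, m))
  (Q : nat -> 'M[R]_n) (Rc : nat -> 'M[R]_m) (theta : nat -> R)
  (m0 : 'cV[R]_n).
Context (d : measure_display) (Omega : measurableType d) (P : probability Omega R).
Variables (x0 : Omega -> 'cV[R]_n) (w : nat -> Omega -> 'cV[R]_n).
Hypothesis psdQ : forall k, (k <= N.+1)%N -> psd (Q k).
Hypothesis pdRc : forall k, (k <= N)%N -> pd (Rc k).
Hypothesis theta0 : forall k, (k <= N)%N -> 0 <= theta k.
Hypothesis L2e0 : L2v P (fun o => x0 o - m0).
Hypothesis L2w : forall k, (k <= N)%N -> L2v P (w k).
Hypothesis syme0 : symmetric_law P (fun o => x0 o - m0).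
Hypothesis symw : forall k, (k <= N)%N -> symmetric_law P (w k).
Hypothesis ind : mutually_independent P
    (fun j : 'I_N.+2 => if val j is j'.+1 then w j' else x0).

Local Notation G := (Gam N A B Q Rc).
Local Notation Sk := (Defs.S N A B Q Rc).
Local Notation Lg := (Lgain N A B Q Rc).
Local Notation Lm := (Lam N A B Q Rc).
Local Notation V := (Ve N A B Q Rc theta P w).
Local Notation ctg := (cost_to_go N A B Q Rc theta P w).
Local Notation rule := (trig_rule N A B Q Rc theta P w).
Local Notation pis := (pi_star N A B Q Rc theta m0 P w).
Local Notation mus := (mu_star N A B Q Rc m0).

Lemma L2v_x0 : L2v P x0.
Proof.
have -> : x0 = (fun o => (x0 o - m0) + m0) by apply/funext => o; rewrite subrK.
by apply: L2vD => //; exact: L2v_cst.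
Qed.

Lemma mvec_x0 : mvec x0.
Proof. exact: L2v_mvec L2v_x0. Qed.

Lemma mvec_w k : (k <= N)%N -> mvec (w k).
Proof. by move=> kN; exact: L2v_mvec (L2w kN). Qed.

Lemma integral_finD (f g : Omega -> R) :
  P.-integrable setT (fun o => (f o)%:E) -> P.-integrable setT (fun o => (g o)%:E) ->
  (\int[P]_o (f o + g o)%:E = \int[P]_o (f o)%:E + \int[P]_o (g o)%:E)%E.
Proof. by move=> If Ig; under eq_integral do rewrite EFinD; rewrite integralD. Qed.

Lemma integral_fin_sum0 I (s : seq I) (f : I -> Omega -> R) :
  (forall i, P.-integrable setT (fun o => (f i o)%:E)) ->
  (forall i, \int[P]_o (f i o)%:E = 0)%E ->
  (\int[P]_o (\sum_(i <- s) f i o)%:E = 0)%E.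
Proof.
move=> If f0; elim: s => [|i s IH].
  by under eq_integral do rewrite big_nil; rewrite integral0.
under eq_integral do rewrite big_cons.
rewrite integral_finD ?f0 ?IH ?adde0//.
exact: integrable_fin_sum.
Qed.

Lemma measurable_xhat_c d' (T : measurableType d') (f : T -> seq (bool * 'cV[R]_n)) t :
  (forall i, (i < t)%N -> measurable_fun setT (fun o => (nth (false, 0) (f o) i).1)) ->
  (forall i, (i < t)%N -> mvec (fun o => (nth (false, 0) (f o) i).2)) ->
  mvec (fun o => xhat_c N A B Q Rc m0 (f o) t).
Proof.
elim: t => [_ _|t IH m1 m2] /=; first exact: mvec_cst.
have mh : mvec (fun o => xhat_c N A B Q Rc m0 (f o) t).
  by apply: IH => i it; [exact: m1 (ltnW it)|exact: m2 (ltnW it)].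
apply: mvecD; first apply: mvecD.
- exact: mvecM.
- by apply: mvecM; apply: mvecN; exact: mvecM.
- apply: mvec_if; [exact: m1| |exact: mvec_cst].
  by apply: mvecM; apply: mvecB => //; exact: m2.
Qed.

Lemma admissible_mu_star : admissible_ctrl N mus.
Proof.
move=> k kN; apply: mvecN; apply: mvecM.
apply: measurable_xhat_c => i ik.
  apply: eq_measurable_fun (measurableT_comp (@measurable_fst _ _ bool (n.-tuple R))
    (measurable_tnth (Ordinal ik))) => t _ /=.
  by rewrite (nth_map_tnth _ _ _ ik).
apply: (@eq_ind _ (fun t : k.-tuple (bool * n.-tuple R) => tupv (tnth t (Ordinal ik)).2)
  (@mvec R _ _ n)).
  apply: (mvec_comp (X := @tupv R n)); last exact: mvec_tupv.
  exact: (measurableT_comp (@measurable_snd _ _ bool (n.-tuple R)) (measurable_tnth _)).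
apply/funext => t.
by rewrite (nth_map_tnth _ _ _ ik).
Qed.

Lemma measurable_xhat_e d' (T : measurableType d') (xs : T -> seq 'cV[R]_n)
    (us : T -> seq 'cV[R]_m) t : (t <= N.+1)%N ->
  (forall i, (i < t)%N -> mvec (fun o => nth 0 (xs o) i)) ->
  (forall i, (i < t)%N -> mvec (fun o => nth 0 (us o) i)) ->
  mvec (fun o => xhat_e N A B Q Rc theta m0 P w (xs o) (us o) t).
Proof.
elim: t => [_ _ _|t IH tN m1 m2]; first exact: mvec_cst.
have mh : mvec (fun o => xhat_e N A B Q Rc theta m0 P w (xs o) (us o) t).
  by apply: IH => [|i it|i it]; [exact: ltnW|exact: m1 (ltnW it)|exact: m2 (ltnW it)].
have me : mvec (fun o => nth 0 (xs o) t - xhat_e N A B Q Rc theta m0 P w (xs o) (us o) t).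
  by apply: mvecB => //; exact: m1.
under eq_fun do rewrite xhat_eS.
apply: mvecD; first apply: mvecD.
- exact: mvecM.
- by apply: mvecM; exact: m2.
- by apply: mvec_if; [exact: measurable_rule|exact: mvecM|exact: mvec_cst].
Qed.

Lemma admissible_pi_star : admissible_trig N pis.
Proof.
move=> k kN.
have mtup k' l i (ik : (i < k')%N) :
    mvec (fun t : k'.-tuple (l.-tuple R) => nth 0 [seq tupv x | x <- t] i).
  apply: (@eq_ind _ (fun t : k'.-tuple (l.-tuple R) => tupv (tnth t (Ordinal ik)))
    (@mvec R _ _ l)).
    apply: (mvec_comp (X := @tupv R l)); last exact: mvec_tupv.
    exact: measurable_tnth.
  apply/funext => t.
  by rewrite (nth_map_tnth _ _ _ ik).
have m1 i (ik : (i < k.+1)%N) := mvec_comp (@measurable_fst _ _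
  (k.+1.-tuple (n.-tuple R)) (k.-tuple (m.-tuple R))) (mtup _ n i ik).
have m2 i (ik : (i < k)%N) := mvec_comp (@measurable_snd _ _
  (k.+1.-tuple (n.-tuple R)) (k.-tuple (m.-tuple R))) (mtup _ m i ik).
apply: measurable_rule => //; apply: mvecB; first exact: m1.
apply: measurable_xhat_e => [|i ik|i ik]; [exact: leqW| |exact: m2].
by apply: m1; exact: ltnW.
Qed.

Section loop.
Variables (pi : trig_policy R n m) (mu : ctrl_policy R n m).
Hypotheses (api : admissible_trig N pi) (amu : admissible_ctrl N mu).
Local Notation x := (fun k o => xp A B pi mu (x0 o) (w^~ o) k).
Local Notation u := (fun k o => up A B pi mu (x0 o) (w^~ o) k).
Local Notation dl := (fun k o => dp A B pi mu (x0 o) (w^~ o) k).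
Local Notation e := (fun k o => err A (x0 o - m0) (w^~ o) (dl^~ o) k).

Lemma loop_measurable k : (k <= N)%N ->
  [/\ mvec (x k), measurable_fun setT (dl k) & mvec (u k)].
Proof.
move=> kN; apply: (measurable_loop A B api amu mvec_x0 kN) => t tk.
by apply: mvec_w; exact: leq_trans (ltnW tk) kN.
Qed.

Lemma loop_measurable_err k : (k <= N.+1)%N -> mvec (e k).
Proof.
move=> kN; apply: (measurable_err A B api amu mvec_x0 kN) => t tk.
by apply: mvec_w; rewrite -ltnS; exact: leq_trans tk kN.
Qed.

Lemma loop_past k : (k <= N)%N ->
  [/\ mvec (x k : past N x0 w k -> _),
      measurable_fun setT (dl k : past N x0 w k -> _),
      mvec (u k : past N x0 w k -> _) &
      mvec (e k : past N x0 w k -> _)].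
Proof.
move=> kN.
have H := measurable_loop A B api amu (@past_x0 R n N _ _ x0 w k) kN
  (fun t tk => @past_w R n N _ _ x0 w k t kN tk).
have He := measurable_err A B api amu (@past_x0 R n N _ _ x0 w k) (leqW kN)
  (fun t tk => @past_w R n N _ _ x0 w k t kN tk) m0.
by have [mx md mu'] := H; split.
Qed.

Lemma L2v_err k : (k <= N.+1)%N -> L2v P (e k).
Proof.
elim: k => [_|k IH kN] /=; first exact: L2e0.
apply: L2vD; last exact: L2w.
have [_ md _] := loop_measurable (kN : (k <= N)%N).
by apply: L2v_if => //; [exact: L2v_cst|apply: L2vM; apply: IH; exact: ltnW].
Qed.

(** The trigger at k is charged with the error at k + 1, the first one it influences, as in the
    value function; the error at time 0 is the same for all policies. *)
Definition stage k o : R := (dl k o)%:R * theta k + qf (G k.+1) (e k.+1 o).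

Lemma loop_stage_ge0 k o : (k <= N)%N -> 0 <= stage k o.
Proof.
by move=> kN; apply: addr_ge0; [rewrite mulr_ge0// theta0|exact: (qf_Gam_ge0 A B psdQ pdRc)].
Qed.

Lemma measurable_dp_theta d' (T : measurableType d') (b : T -> bool) (c : R) :
  measurable_fun setT b -> measurable_fun setT (fun t => (b t)%:R * c).
Proof.
move=> mb; apply: (@eq_measurable_fun _ _ _ _ _ (fun t => if b t then c else 0)).
  by move=> t _; case: (b t); rewrite ?mul1r ?mul0r.
exact: measurable_fun_ifT.
Qed.

Lemma measurable_loop_stage k : (k <= N)%N -> measurable_fun setT (stage k).
Proof.
move=> kN; have [_ md _] := loop_measurable kN.
apply: measurable_funD; first exact: measurable_dp_theta.
by apply: measurable_qf; exact: loop_measurable_err.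
Qed.

Lemma value_step_integral k : (k <= N)%N ->
  (\int[P]_o ((stage k o)%:E + V k.+1 (e k.+1 o)) =
   \int[P]_o (((dl k o)%:R * theta k)%:E
      + ctg k (if dl k o then 0 else A k *m e k o)%R))%E.
Proof.
move=> kN; have [_ md _ me] := loop_past kN.
pose y o := if dl k o then 0 else A k *m e k o.
have my : mvec (y : past N x0 w k -> _).
  by apply: mvec_if => //; exact: mvecM.
pose F o v : \bar R := (((dl k o)%:R * theta k)%:E +
  ((qf (G k.+1) (y o + v)%R)%:E + V k.+1 (y o + v)%R))%E.
have V0 v := V_ge0 A B psdQ pdRc theta0 L2w symw v (kN : (k.+1 <= N.+1)%N).
have S0 v := stage_ge0 psdQ pdRc v V0.
have mV := mcv_V A B psdQ pdRc theta0 L2w symw (kN : (k.+1 <= N.+1)%N).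
have th0 o : (0 <= ((dl k o)%:R * theta k)%:E)%E by rewrite lee_fin mulr_ge0// theta0.
have mF : measurable_fun [set: past N x0 w k * n.-tuple R] (fun z => F z.1 (tupv z.2)).
  apply: emeasurable_funD.
    apply/measurable_EFinP; apply: measurable_dp_theta.
    exact: (measurableT_comp md).
  apply: measurable_stage => //; apply: mvecD.
    exact: (mvec_comp (X := y : past N x0 w k -> _)).
  by apply: (mvec_comp (X := @tupv R n)) => //; exact: mvec_tupv.
transitivity (\int[P]_o F o (w k o))%E.
  by apply: eq_integral => o _; rewrite /F /stage EFinD addeA.
rewrite (past_integral mvec_x0 mvec_w ind kN mF); last first.
  by move=> o v; rewrite adde_ge0.
apply: eq_integral => o _; rewrite /F ge0_integralD//.
- by congr (_ + _)%E; rewrite integral_cst//= probability_setT mule1.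
- apply: measurable_stage => //; apply: mvecD; [exact: mvec_cst|exact: mvec_w].
Qed.

(** The Bellman inequality, integrated over the sample space: the value is at most either branch,
    and the rule selects the smaller one. *)
Lemma value_step k : (k <= N)%N ->
  (\int[P]_o V k (e k o) <= \int[P]_o ((stage k o)%:E + V k.+1 (e k.+1 o)))%E /\
  ((forall o, dl k o = rule k (e k o)) ->
   \int[P]_o V k (e k o) = \int[P]_o ((stage k o)%:E + V k.+1 (e k.+1 o)))%E.
Proof.
move=> kN; rewrite value_step_integral//; split; last first.
  move=> H; apply: eq_integral => o _.
  rewrite (rule_min A B psdQ pdRc theta0 L2w symw)// -H.
  by case: (dl k o); rewrite ?mul1r ?mul0r ?add0e.
have V0 v := V_ge0 A B psdQ pdRc theta0 L2w symw v (kN : (k.+1 <= N.+1)%N).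
have mV := mcv_V A B psdQ pdRc theta0 L2w symw (kN : (k.+1 <= N.+1)%N).
have C0 y := cost_to_go_ge0 psdQ pdRc y V0.
have [_ md _] := loop_measurable kN.
have me := loop_measurable_err (leqW kN).
apply: ge0_le_integral => //.
- by move=> o _; exact: (V_ge0 A B psdQ pdRc theta0 L2w symw _ (leqW kN)).
- by apply: mcv_comp => //; exact: (mcv_V A B psdQ pdRc theta0 L2w symw (leqW kN)).
- apply: emeasurable_funD; first by apply/measurable_EFinP; exact: measurable_dp_theta.
  apply: mcv_comp; first exact: (mcv_cost_to_go psdQ pdRc L2w kN).
  by apply: mvec_if => //; exact: mvecM.
- move=> o _; rewrite Ve_rec//.
  by case: (dl k o); rewrite ?mul1r ?mul0r ?add0e ge_min lexx ?orbT.
Qed.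

Lemma value_sum j : (j <= N.+1)%N ->
  (\int[P]_o V 0%N (e 0%N o) <=
    \int[P]_o (\sum_(k < j) stage k o)%:E + \int[P]_o V j (e j o))%E /\
  ((forall k o, dl k o = rule k (e k o)) -> (\int[P]_o V 0%N (e 0%N o) =
    \int[P]_o (\sum_(k < j) stage k o)%:E + \int[P]_o V j (e j o))%E).
Proof.
elim: j => [_|j IH jN].
  by under [X in (_ <= X + _)%E]eq_integral do rewrite big_ord0;
     under [X in (_ = X + _)%E]eq_integral do rewrite big_ord0;
     rewrite integral0 add0e; split.
have jN' : (j <= N)%N by [].
have S0 o : 0 <= \sum_(k < j) stage k o.
  by apply: sumr_ge0 => k _; apply: loop_stage_ge0; exact: leq_trans (ltnW (ltn_ord k)) jN'.
have mS : measurable_fun setT (fun o => \sum_(k < j) stage k o).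
  apply: measurable_sum => k; apply: measurable_loop_stage.
  exact: leq_trans (ltnW (ltn_ord k)) jN'.
have mst := measurable_loop_stage jN'.
have E : (\int[P]_o (\sum_(k < j) stage k o)%:E +
    \int[P]_o ((stage j o)%:E + V j.+1 (e j.+1 o)) =
    \int[P]_o (\sum_(k < j.+1) stage k o)%:E + \int[P]_o V j.+1 (e j.+1 o))%E.
  under [X in _ = (X + _)%E]eq_integral do rewrite big_ord_recr/= EFinD.
  have mVe : measurable_fun setT (fun o => V j.+1 (e j.+1 o)).
    by apply: mcv_comp; [exact: (mcv_V A B psdQ pdRc theta0 L2w symw jN)|exact: loop_measurable_err].
  have Ve0 o : setT o -> (0 <= V j.+1 (e j.+1 o))%E.
    by move=> _; exact: (V_ge0 A B psdQ pdRc theta0 L2w symw _ jN).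
  have mst' : measurable_fun setT (fun o => (stage j o)%:E) by exact/measurable_EFinP.
  have st0 o : setT o -> (0 <= (stage j o)%:E)%E by move=> _; rewrite lee_fin loop_stage_ge0.
  have mS' : measurable_fun setT (fun o => (\sum_(k < j) stage k o)%:E).
    exact/measurable_EFinP.
  have S0' o : setT o -> (0 <= (\sum_(k < j) stage k o)%:E)%E by rewrite lee_fin.
  by rewrite (ge0_integralD _ _ st0 mst' Ve0 mVe)// (ge0_integralD _ _ S0' mS' st0 mst')// addeA.
have [IH1 IH2] := IH (ltnW jN); have [ST1 ST2] := value_step jN'.
rewrite -E; split; first by apply: (le_trans IH1); exact: leeD2l.
by move=> H; rewrite IH2// ST2.
Qed.

Lemma value_total :
  (\int[P]_o V 0%N (e 0%N o) <= \int[P]_o (\sum_(k < N.+1) stage k o)%:E)%E /\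
  ((forall k o, dl k o = rule k (e k o)) -> (\int[P]_o V 0%N (e 0%N o) =
    \int[P]_o (\sum_(k < N.+1) stage k o)%:E)%E).
Proof.
have := value_sum (leqnn N.+1).
have -> : (\int[P]_o V N.+1 (e N.+1 o) = 0)%E.
  by under eq_integral do rewrite Ve_last; rewrite integral0.
by rewrite adde0.
Qed.

(* What remains of the cost after completing the square along the Riccati
   recursion, up to [noise_cost] and mean-zero terms. *)
Definition control_loss k o : R :=
  qf (Lm k) (u k o + Lg k *m x k o) + (dl k o)%:R * theta k.

Definition noise_cost o : R :=
  qf (Sk 0) (x0 o) + \sum_(k < N.+1) qf (Sk k.+1) (w k o).

Lemma cost_decomposition o :
  cost N A B Q Rc theta pi mu (x0 o) (w^~ o) =
  noise_cost o + \sum_(k < N.+1) control_loss k o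
  + \sum_(k < N.+1) 2 * ((w k o)^T *m Sk k.+1 *m (A k *m x k o + B k *m u k o)) 0 0.
Proof.
rewrite costE.
have SN : Q N.+1 = Sk N.+1 by rewrite /Defs.S subnn.
rewrite SN.
(* Partial horizons, with S_j as terminal weight, make the telescoping an induction. *)
have T j : (j <= N.+1)%N -> qf (Sk j) (x j o) + \sum_(k < j) (qf (Q k) (x k o) + qf (Rc k) (u k o)
     + (dl k o)%:R * theta k) = qf (Sk 0) (x0 o) + \sum_(k < j) qf (Sk k.+1) (w k o)
   + \sum_(k < j) control_loss k o
   + \sum_(k < j) 2 * ((w k o)^T *m Sk k.+1 *m (A k *m x k o + B k *m u k o)) 0 0.
  elim: j => [_|j IH jN]; first by rewrite !big_ord0 !addr0.
  have := IH (ltnW jN); rewrite !big_ord_recr/=.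
  rewrite (riccati_step A B psdQ pdRc (x j o) (u j o) (w j o) (jN : (j <= N)%N)) /control_loss -xpS.
  by move=> H; lra.
by rewrite T.
Qed.

Hypotheses (L2x : forall k, (k <= N)%N -> L2v P (x k))
  (L2u : forall k, (k <= N)%N -> L2v P (u k)).

Lemma integrable_dp_theta k : (k <= N)%N ->
  P.-integrable setT (fun o => ((dl k o)%:R * theta k)%:E).
Proof.
move=> kN; have [_ md _] := loop_measurable kN.
apply: (@le_integrable_fin _ _ _ _ _ (fun=> theta k)).
- exact: measurable_dp_theta.
- move=> o; have t0 := theta0 kN.
  by case: (dl k o); rewrite ?mul1r ?mul0r ?normr0 ?ger0_norm.
- exact: finite_measure_integrable_cst.
Qed.

Lemma integrable_noise_cost : P.-integrable setT (fun o => (noise_cost o)%:E).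
Proof.
apply: integrable_finD; first exact: integrable_qf L2v_x0.
by apply: integrable_fin_sum => k; apply: integrable_qf; apply: L2w; rewrite -ltnS.
Qed.

Lemma integrable_control_loss : P.-integrable setT
  (fun o => (\sum_(k < N.+1) control_loss k o)%:E).
Proof.
apply: integrable_fin_sum => k; have kN : (k <= N)%N by rewrite -ltnS.
apply: integrable_finD; last exact: integrable_dp_theta.
apply: (@integrable_qf _ _ _ P _ (Lm k) (fun o => u k o + Lg k *m x k o)).
by apply: L2vD; [exact: L2u|apply: L2vM; exact: L2x].
Qed.

(** Square integrability allows the integral to be split; each cross term pairs w_k with a vector
    determined by its past, hence has mean zero. *)
Lemma Psi_decomposition : Psi N A B Q Rc theta P w x0 pi mu =
  (\int[P]_o (noise_cost o)%:E + \int[P]_o (\sum_(k < N.+1) control_loss k o)%:E)%E.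
Proof.
rewrite /Psi; under eq_integral do rewrite cost_decomposition.
have kN (k : 'I_N.+1) : (k <= N)%N by rewrite -ltnS.
have Ic (k : 'I_N.+1) : P.-integrable setT (fun o =>
    (((w k o)^T *m Sk k.+1 *m (A k *m x k o + B k *m u k o)) 0 0)%:E).
  apply: (@integrable_bilinear _ _ _ P _ _ (Sk k.+1) (w k)
    (fun o => A k *m x k o + B k *m u k o)); first exact: L2w.
  by apply: L2vD; apply: L2vM; [exact: L2x|exact: L2u].
have IC (k : 'I_N.+1) : P.-integrable setT (fun o =>
    (2 * ((w k o)^T *m Sk k.+1 *m (A k *m x k o + B k *m u k o)) 0 0)%:E).
  exact: integrable_finZ.
have I1 := integrable_noise_cost; have I2 := integrable_control_loss.
have Z : (\int[P]_o (\sum_(k < N.+1) 2 * ((w k o)^T *m Sk k.+1 *m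
    (A k *m x k o + B k *m u k o)) 0 0)%:E = 0)%E.
  apply: integral_fin_sum0 => // k.
  under eq_integral do rewrite EFinM.
  rewrite integralZl// (past_orthogonal mvec_x0 mvec_w symw ind (kN k)) ?mule0//.
  have [mx _ mu' _] := loop_past (kN k).
  by apply: mvecD; exact: mvecM.
rewrite integral_finD; [|exact: integrable_finD|exact: integrable_fin_sum].
by rewrite Z adde0 integral_finD.
Qed.

End loop.

(** * Best response of the trigger to [mu_star] *)

Section trigger.
Variable pi : trig_policy R n m.
Hypothesis api : admissible_trig N pi.
Local Notation x := (fun k o => xp A B pi mus (x0 o) (w^~ o) k).
Local Notation u := (fun k o => up A B pi mus (x0 o) (w^~ o) k).
Local Notation dl := (fun k o => dp A B pi mus (x0 o) (w^~ o) k).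
Local Notation e := (fun k o => err A (x0 o - m0) (w^~ o) (dl^~ o) k).
Local Notation xh := (fun k o => xhc A B N Q Rc m0 pi (x0 o) (w^~ o) k).

Lemma L2v_xhc k : (k <= N.+1)%N -> L2v P (xh k).
Proof.
elim: k => [_|k IH kN]; first exact: L2v_cst.
have [_ md _] := loop_measurable api admissible_mu_star (kN : (k <= N)%N).
have IHk := IH (ltnW kN).
under [X in L2v _ X]eq_fun do rewrite xhcS err_mu_star up_mu_star.
apply: L2vD; first apply: L2vD; first exact: L2vM.
- by apply: L2vM; apply: L2vN; exact: L2vM.
- apply: L2v_if => //; last exact: L2v_cst.
  by apply: L2vM; apply: L2v_err => //; [exact: admissible_mu_star|exact: ltnW].
Qed.

Lemma L2v_mu_star k : (k <= N)%N -> L2v P (x k) /\ L2v P (u k).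
Proof.
move=> kN; have lh := L2v_xhc (leqW kN); split.
  have -> : x k = (fun o => xh k o + e k o).
    by apply/funext => o; rewrite -err_mu_star addrC subrK.
  by apply: L2vD => //; apply: L2v_err => //; [exact: admissible_mu_star|exact: leqW].
by under [X in L2v _ X]eq_fun do rewrite up_mu_star; apply: L2vN; exact: L2vM.
Qed.

Lemma control_loss_mu_star k o : (k <= N)%N ->
  control_loss pi mus k o = qf (G k) (e k o) + (dl k o)%:R * theta k.
Proof.
move=> kN; rewrite /control_loss up_mu_star; congr (_ + _).
by rewrite [X in qf _ X]addrC -mulmxBr err_mu_star (qf_Gam A B psdQ pdRc).
Qed.

Lemma Psi_mu_star : Psi N A B Q Rc theta P w x0 pi mus =
  (\int[P]_o (noise_cost o)%:E + (\int[P]_o (qf (G 0%N) (x0 o - m0)%R)%:E +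
   \int[P]_o (\sum_(k < N.+1) stage pi mus k o)%:E))%E.
Proof.
rewrite (Psi_decomposition api admissible_mu_star); last 2 first.
- by move=> k /L2v_mu_star[].
- by move=> k /L2v_mu_star[].
congr (_ + _)%E.
have E o : \sum_(k < N.+1) control_loss pi mus k o =
    qf (G 0) (x0 o - m0) + \sum_(k < N.+1) stage pi mus k o.
  under eq_bigr => k _ do rewrite (control_loss_mu_star _ (ltn_ord k : (k <= N)%N)).
  rewrite /stage !big_split/= addrA [RHS]addrAC; congr (_ + _).
  (* Shifts the index: the initial error joins the sum, and the last term vanishes because
     Gamma_(N+1) = 0. *)
  have -> : qf (G 0) (x0 o - m0) + \sum_(k < N.+1) qf (G k.+1) (e k.+1 o) =
      \sum_(k < N.+2) qf (G k) (e k o) by rewrite [RHS]big_ord_recl.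
  have GN : G N.+1 = 0 by rewrite /Gam ltnn.
  by rewrite [RHS]big_ord_recr/= GN qf_mx0 addr0.
under eq_integral do rewrite E.
rewrite integral_finD//; first exact: integrable_qf L2e0.
apply: integrable_fin_sum => k; have kN : (k <= N)%N by rewrite -ltnS.
apply: integrable_finD.
  exact: integrable_dp_theta api admissible_mu_star _ kN.
apply: (@integrable_qf _ _ _ P _ (G k.+1) (e k.+1)).
by apply: L2v_err => //; exact: admissible_mu_star.
Qed.

End trigger.

Lemma trigger_optimal pi : admissible_trig N pi ->
  (Psi N A B Q Rc theta P w x0 pis mus <= Psi N A B Q Rc theta P w x0 pi mus)%E.
Proof.
move=> api; rewrite (Psi_mu_star api) (Psi_mu_star admissible_pi_star).
apply: leeD2l; apply: leeD2l.
have [+ _] := value_total api admissible_mu_star.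
have [_ <-//] := value_total admissible_pi_star admissible_mu_star.
by move=> k o; exact: dp_pi_star_err.
Qed.

(** * Best response of the controller to [pi_star] *)

Section control.
Variable mu : ctrl_policy R n m.
Hypothesis amu : admissible_ctrl N mu.
Let api := admissible_pi_star.
Local Notation x := (fun k o => xp A B pis mu (x0 o) (w^~ o) k).
Local Notation u := (fun k o => up A B pis mu (x0 o) (w^~ o) k).
Local Notation dl := (fun k o => dp A B pis mu (x0 o) (w^~ o) k).
Local Notation e := (fun k o => err A (x0 o - m0) (w^~ o) (dl^~ o) k).
Local Notation xh := (fun k o => x k o - e k o).
Local Notation info := (info_tuple A B pis mu x0 w).

(** The noise enters state and error alike and cancels, so the estimate evolves through the control
    and the transmitted error only. *)
Lemma xhS k o : xh k.+1 o = A k *m xh k o + B k *m u k o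
  + (if dl k o then A k *m e k o else 0).
Proof.
cbv beta; rewrite xpS /= opprD addrACA subrr addr0 mulmxBr.
case: (dl k o); last by rewrite addr0 addrAC.
by rewrite subr0 [RHS]addrAC subrK.
Qed.

(** Controller information, estimate and error together form a Markov state: the next one is a
    function of the present one and the fresh noise. *)
Definition obs_type k : measurableType _ :=
  (k.-tuple (bool * n.-tuple R) * (n.-tuple R * n.-tuple R))%type.

Definition obs k o : obs_type k := (info k o, (vtup (xh k o), vtup (e k o))).

Definition obs_flip k (z : obs_type k) : obs_type k :=
  (z.1, (z.2.1, vtup (- tupv z.2.2))).

Definition obs_trigger k (z : obs_type k) : bool := rule k (tupv z.2.2).

(* [s] reverses the inherited error; [obs_next false] is the actual dynamics. *)
Definition obs_next k (s : bool) (z : obs_type k) (v : 'cV[R]_n) : obs_type k.+1 :=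
  let b := obs_trigger z in let xe := tupv z.2.2 in let xx := tupv z.2.1 in
  ([tuple of rcons z.1 (b, vtup (if b then xx + xe else 0))],
   (vtup (A k *m xx + B k *m mu k [seq (p.1, tupv p.2) | p <- z.1]
          + (if b then A k *m xe else 0)),
    vtup ((if b then 0 else A k *m (if s then - xe else xe)) + v))).

Lemma obsS k o : obs k.+1 o = obs_next false (obs k o) (w k o).
Proof.
have dE : dl k o = obs_trigger (obs k o).
  by rewrite /obs_trigger vtupK; exact: dp_pi_star_err.
congr (_, (_, _)).
- apply: val_inj; rewrite /= -dE !vtupK.
  rewrite -[LHS]map_id (mkseq_tuple id (fun i => ((ip A B pis mu (x0 o) (w^~ o) i).1,
    vtup (ip A B pis mu (x0 o) (w^~ o) i).2))) mkseqS.
  congr rcons; last by rewrite subrK.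
  by rewrite -(mkseq_tuple id) map_id.
- by rewrite xhS -dE !vtupK info_tupleE -upE.
- by rewrite /= -dE !vtupK.
Qed.

Lemma obs_flip_next k (z : obs_type k) v :
  obs_flip (obs_next false z v) = obs_next true z (- v).
Proof.
congr (_, (_, _)); rewrite /= vtupK opprD mulmxN.
by case: (obs_trigger z); rewrite ?oppr0.
Qed.

Lemma obs_trigger_flip k (z : obs_type k) : (k <= N)%N ->
  obs_trigger (obs_flip z) = obs_trigger z.
Proof.
move=> kN; rewrite /obs_trigger /= vtupK /trig_rule.
by rewrite (VoI_even A B psdQ pdRc theta0 L2w symw).
Qed.

(** After a transmission the inherited error is absent from the next error, so reversing it there
    changes nothing. After a silence it is absent from the information and the estimate, so the
    reversal amounts to flipping [z] beforehand. *)
Lemma obs_next_true k (z : obs_type k) v : (k <= N)%N ->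
  obs_next true z v =
  if obs_trigger z then obs_next false z v else obs_next false (obs_flip z) v.
Proof.
move=> kN; have H := obs_trigger_flip z kN; rewrite /obs_next H.
by case: ifP => //= _; rewrite vtupK.
Qed.

Lemma measurable_obs_trigger k : (k <= N)%N ->
  measurable_fun setT (@obs_trigger k).
Proof.
move=> kN; apply: (measurable_rule A B psdQ pdRc theta0 L2w symw) => //.
apply: (mvec_comp (X := @tupv R n)); last exact: mvec_tupv.
exact: (measurableT_comp measurable_snd measurable_snd).
Qed.

Lemma measurable_obs_next k s d' (T : measurableType d') (f : T -> obs_type k)
    (v : T -> 'cV[R]_n) : (k <= N)%N -> measurable_fun setT f -> mvec v ->
  measurable_fun setT (fun t => obs_next s (f t) (v t)).
Proof.
move=> kN mf mv.
have mb : measurable_fun setT (fun t => obs_trigger (f t)).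
  exact: (measurableT_comp (measurable_obs_trigger kN) mf).
have m1 : measurable_fun setT (fun t => (f t).1) by exact: (measurableT_comp measurable_fst mf).
have m2 : measurable_fun setT (fun t => (f t).2) by exact: (measurableT_comp measurable_snd mf).
have mx : mvec (fun t => tupv (f t).2.1).
  apply: (mvec_comp (X := @tupv R n)); last exact: mvec_tupv.
  exact: (measurableT_comp measurable_fst m2).
have me : mvec (fun t => tupv (f t).2.2).
  apply: (mvec_comp (X := @tupv R n)); last exact: mvec_tupv.
  exact: (measurableT_comp measurable_snd m2).
have mu' : mvec (fun t => mu k [seq (p.1, tupv p.2) | p <- (f t).1]).
  by move=> i; exact: (measurableT_comp (amu kN i) m1).
apply: measurable_fun_pair; [|apply: measurable_fun_pair; apply/mvec_vtup].
- apply: measurable_rcons_tuple => //; apply: measurable_fun_pair => //.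
  by apply/mvec_vtup; apply: mvec_if => //; exact: mvecD.
- apply: mvecD; first by apply: mvecD; exact: mvecM.
  by apply: mvec_if => //; exact: mvecM.
- apply: mvecD => //; apply: mvec_if => //; apply: mvecM.
  by case: s => //; exact: mvecN.
Qed.

Lemma measurable_obs_past k : (k <= N)%N ->
  measurable_fun setT (obs k : past N x0 w k -> obs_type k).
Proof.
move=> kN; have [mx _ _ me] := loop_past api amu kN.
apply: measurable_fun_pair; last first.
  apply: measurable_fun_pair; apply/mvec_vtup => //; exact: mvecB.
apply: measurable_info_tuple => j jk.
have [] // := measurable_loop A B api amu (@past_x0 R n N _ _ x0 w k)
  (leq_trans (ltnW jk) kN) (fun t tj => @past_w R n N _ _ x0 w k t kN (ltn_trans tj jk)).
Qed.

Lemma measurable_obs k : (k <= N)%N -> measurable_fun setT (obs k).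
Proof.
move=> kN; have [mx _ _] := loop_measurable api amu kN.
have me := loop_measurable_err api amu (leqW kN).
apply: measurable_fun_pair; last first.
  apply: measurable_fun_pair; apply/mvec_vtup => //; exact: mvecB.
apply: measurable_info_tuple => j jk.
by have [] := loop_measurable api amu (leq_trans (ltnW jk) kN).
Qed.

Lemma measurable_obs_flip k : measurable_fun setT (@obs_flip k).
Proof.
apply: measurable_fun_pair => //; apply: measurable_fun_pair.
  exact: (measurableT_comp measurable_fst measurable_snd).
apply/mvec_vtup; apply: mvecN; apply: (mvec_comp (X := @tupv R n)); last exact: mvec_tupv.
exact: (measurableT_comp measurable_snd measurable_snd).
Qed.

(* The error is symmetric conditionally on what the controller observes: a
   non-transmission reveals only [rule k (e k)], which is even in the error, and
   a transmission leaves only the fresh noise in the next error. *)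
Lemma obs_symmetric k : (k <= N)%N ->
  forall F : obs_type k -> \bar R, measurable_fun setT F -> (forall z, 0 <= F z)%E ->
  (\int[P]_o F (obs k o) = \int[P]_o F (obs_flip (obs k o)))%E.
Proof.
elim: k => [_|k IH kN] F mF F0.
  (* At time 0 nothing has been received and the estimate is the constant [m0]; only the symmetric
     initial error is random. *)
  pose z0 v : obs_type 0 := ([tuple], (vtup m0, vtup v)).
  have E o : obs 0 o = z0 (x0 o - m0).
    by congr (_, (vtup _, _)); [exact: tuple0|rewrite /= subKr].
  under eq_integral do rewrite E.
  rewrite (syme0 (F := fun v => F (z0 v)))//.
    by apply: eq_integral => o _; rewrite E /obs_flip /z0 /= vtupK.
  apply: (measurableT_comp mF); apply: measurable_fun_pair => //.
  by apply: measurable_fun_pair => //; apply/mvec_vtup; exact: mvec_tupv.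
have kN' : (k <= N)%N := ltnW kN.
have mN s : measurable_fun [set: past N x0 w k * n.-tuple R]
    (fun z => F (obs_next s (obs k z.1) (tupv z.2))).
  apply: (measurableT_comp mF); apply: measurable_obs_next => //.
    exact: (measurableT_comp (measurable_obs_past kN') measurable_fst).
  by apply: (mvec_comp (X := @tupv R n)) => //; exact: mvec_tupv.
have PI s : (\int[P]_o F (obs_next s (obs k o) (w k o)) =
    \int[P]_o \int[P]_p F (obs_next s (obs k o) (w k p)))%E.
  exact: (past_integral mvec_x0 mvec_w ind kN'
    (F := fun o v => F (obs_next s (obs k o) v)) (mN s)).
have PF : (\int[P]_o F (obs_next true (obs k o) (w k o)) =
    \int[P]_o F (obs_next true (obs k o) (- w k o)%R))%E.
  exact: (past_flip mvec_x0 mvec_w symw ind kN'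
    (F := fun o v => F (obs_next true (obs k o) v)) (mN true)).
pose H (z : obs_type k) : \bar R := (\int[P]_p F (obs_next false z (w k p)))%E.
have mH : measurable_fun setT H.
  pose f (y : obs_type k * Omega) := F (obs_next false y.1 (w k y.2)).
  apply: (@measurable_fun_fubini_tonelli_F _ _ _ _ _ P f); last by move=> y; exact: F0.
  apply: (measurableT_comp mF); apply: measurable_obs_next => //.
  by apply: (mvec_comp (X := w k)) => //; exact: mvec_w.
have H0 z : (0 <= H z)%E by exact: integral_ge0.
have mb := measurable_obs_trigger kN'.
(* The expected next value is split by the trigger. The induction hypothesis flips only the silent
   part [K0], since flipping the transmitting part would alter the transmitted state. *)
pose K1 z : \bar R := if obs_trigger z then H z else 0%E.
pose K0 z : \bar R := if obs_trigger z then 0%E else H z.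
have mK1 : measurable_fun setT K1.
  exact: (measurable_fun_ifT mb mH (measurable_cst _)).
have mK0 : measurable_fun setT K0.
  exact: (measurable_fun_ifT mb (measurable_cst _) mH).
have K10 z : (0 <= K1 z)%E by rewrite /K1; case: ifP.
have K00 z : (0 <= K0 z)%E by rewrite /K0; case: ifP.
have mo := measurable_obs kN'; have mfl := @measurable_obs_flip k.
transitivity (\int[P]_o (K1 (obs k o) + K0 (obs k o)))%E.
  under eq_integral do rewrite obsS.
  rewrite PI.
  apply: eq_integral => o _; rewrite -/(H _) /K1 /K0.
  by case: ifP; rewrite ?adde0 ?add0e.
transitivity (\int[P]_o (K1 (obs k o) + K0 (obs_flip (obs k o))))%E.
  have m1 : measurable_fun setT (fun o => K1 (obs k o)) by exact: (measurableT_comp mK1 mo).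
  have m0' : measurable_fun setT (fun o => K0 (obs k o)) by exact: (measurableT_comp mK0 mo).
  have m0'' : measurable_fun setT (fun o => K0 (obs_flip (obs k o))).
    exact: (measurableT_comp mK0 (measurableT_comp mfl mo)).
  apply: etrans (ge0_integralD P measurableT (fun o _ => K10 (obs k o)) m1
    (fun o _ => K00 (obs k o)) m0') _.
  apply: etrans (esym (ge0_integralD P measurableT (fun o _ => K10 (obs k o)) m1
    (fun o _ => K00 (obs_flip (obs k o))) m0'')).
  exact: (f_equal (fun t => (\int[P]_o K1 (obs k o) + t)%E) (IH kN' K0 mK0 K00)).
under [RHS]eq_integral do rewrite obsS obs_flip_next.
rewrite -PF PI.
apply: eq_integral => o _.
under [RHS]eq_integral do rewrite obs_next_true//.
rewrite /K1 /K0 obs_trigger_flip//.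
by case: ifP => _; rewrite ?adde0 ?add0e.
Qed.

(** The left factor depends on information and estimate, which the flip fixes, while the error
    changes sign. *)
Lemma control_error_orthogonal k : (k <= N)%N -> forall M : 'M[R]_(m, n),
  P.-integrable setT (fun o => (((u k o + Lg k *m xh k o)^T *m M *m e k o) 0 0)%:E) ->
  (\int[P]_o (((u k o + Lg k *m xh k o)^T *m M *m e k o) 0 0)%:E = 0)%E.
Proof.
move=> kN M I; apply: integral_odd_eq0 => //.
pose F (z : obs_type k) : \bar R := (Num.max (((mu k [seq (p.1, tupv p.2) | p <- z.1]
  + Lg k *m tupv z.2.1)^T *m M *m tupv z.2.2) 0 0) 0)%:E.
have E o : F (obs k o) = (Num.max (((u k o + Lg k *m xh k o)^T *m M *m e k o) 0 0) 0)%:E.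
  by rewrite /F /= info_tupleE !vtupK -upE.
have E' o : F (obs_flip (obs k o)) =
    (Num.max (- ((u k o + Lg k *m xh k o)^T *m M *m e k o) 0 0) 0)%:E.
  rewrite /F /= info_tupleE !vtupK -upE mulmxN; congr (Num.max _ 0)%:E.
  by rewrite [LHS]mxE.
transitivity (\int[P]_o F (obs k o))%E; first by apply: eq_integral => o _; rewrite E.
rewrite (obs_symmetric kN); first by apply: eq_integral => o _; rewrite E'.
- apply/measurable_EFinP; apply: measurable_maxr => //; apply: measurable_bilinear.
    apply: mvecD; first by move=> i; exact: (measurableT_comp (amu kN i)).
    apply: mvecM; apply: (mvec_comp (X := @tupv R n)); last exact: mvec_tupv.
    exact: (measurableT_comp measurable_fst measurable_snd).
  apply: (mvec_comp (X := @tupv R n)); last exact: mvec_tupv.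
  exact: (measurableT_comp measurable_snd measurable_snd).
- by move=> z; rewrite lee_fin le_max lexx orbT.
Qed.

Lemma cost_ge0 o : 0 <= cost N A B Q Rc theta pis mu (x0 o) (w^~ o).
Proof.
rewrite costE addr_ge0//; first by have [_] := psdQ (leqnn N.+1); apply.
apply: sumr_ge0 => k _; have kN : (k <= N)%N := ltn_ord k.
rewrite !addr_ge0//; first by have [_] := psdQ (leqW kN); apply.
- have [->|u0] := eqVneq (u k o) 0; first by rewrite qf0.
  by apply/ltW; apply: (pdRc kN).2.
- by rewrite mulr_ge0// theta0.
Qed.

(** The Q_k are only semidefinite, so the states are not controlled by the cost directly: the R_k
    bound the controls, and the dynamics propagate square integrability to the states. *)
Lemma finite_Psi_L2v : (Psi N A B Q Rc theta P w x0 pis mu < +oo)%E ->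
  forall k, (k <= N)%N -> L2v P (x k) /\ L2v P (u k).
Proof.
move=> fin.
have mxN : mvec (x N.+1).
  have [mx _ mu'] := loop_measurable api amu (leqnn N).
  apply: (@eq_ind _ (fun o => A N *m x N o + B N *m u N o + w N o) (@mvec R d Omega n)).
    by apply: mvecD; [apply: mvecD; exact: mvecM|exact: mvec_w].
  by apply/funext => o; rewrite xpS.
have Icost : P.-integrable setT
    (fun o => (cost N A B Q Rc theta pis mu (x0 o) (w^~ o))%:E).
  apply/integrableP; split; last first.
    apply: le_lt_trans fin; rewrite /Psi le_eqVlt; apply/orP; left; apply/eqP.
    by apply: eq_integral => o _; rewrite gee0_abs// lee_fin cost_ge0.
  apply/measurable_EFinP; under eq_fun do rewrite costE.
  apply: measurable_funD; first exact: measurable_qf.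
  apply: measurable_sum => k; have kN : (k <= N)%N := ltn_ord k.
  have [mx md mu'] := loop_measurable api amu kN.
  apply: measurable_funD; last exact: measurable_dp_theta.
  by apply: measurable_funD; exact: measurable_qf.
have Lu k : (k <= N)%N -> L2v P (u k).
  move=> kN i; have [_ _ mu'] := loop_measurable api amu kN.
  split; first exact: mu'.
  have [c Hc] := pd_coord_le (pdRc kN) i.
  (* The constant [c] is supplied without a sign, hence the absolute value. *)
  apply: (@le_integrable_fin _ _ _ _ _ (fun o => `|c| *
    cost N A B Q Rc theta pis mu (x0 o) (w^~ o))); last exact: integrable_finZ.
    by apply: measurable_funX; exact: mu'.
  have qu0 j o : (j <= N)%N -> 0 <= qf (Rc j) (u j o).
    move=> jN; have [->|u0] := eqVneq (u j o) 0; first by rewrite qf0.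
    by apply/ltW; apply: (pdRc jN).2.
  move=> o; rewrite ger0_norm ?sqr_ge0//; apply: (le_trans (Hc _)).
  apply: (@le_trans _ _ (`|c| * qf (Rc k) (u k o))).
    by rewrite ler_wpM2r ?qu0// ler_norm.
  rewrite ler_wpM2l// costE (bigD1 (Ordinal (kN : (k < N.+1)%N)))//=.
  have q0 j o' : (j <= N.+1)%N -> 0 <= qf (Q j) (x j o').
    by move=> jN; have [_] := psdQ jN; apply.
  have a1 := q0 N.+1 o (leqnn _); have a2 := q0 k o (leqW kN).
  have a3 : 0 <= (dl k o)%:R * theta k by rewrite mulr_ge0// theta0.
  set rest := \sum_(_ | _) _.
  have a4 : 0 <= rest.
    apply: sumr_ge0 => j _; have jN : (j <= N)%N := ltn_ord j.
    by rewrite !addr_ge0 ?q0 ?qu0 ?mulr_ge0 ?theta0//; exact: leqW.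
  lra.
move=> k kN; split; last exact: Lu.
elim: k kN => [_|k IH kN]; first exact: L2v_x0.
under [X in L2v _ X]eq_fun do rewrite xpS.
apply: L2vD; last exact: L2w (ltnW kN).
by apply: L2vD; apply: L2vM; [exact: IH (ltnW kN)|exact: Lu (ltnW kN)].
Qed.

Lemma control_optimal :
  (Psi N A B Q Rc theta P w x0 pis mus <= Psi N A B Q Rc theta P w x0 pis mu)%E.
Proof.
have [->|] := eqVneq (Psi N A B Q Rc theta P w x0 pis mu) +oo%E; first exact: leey.
rewrite -ltey => fin.
have Lxu := finite_Psi_L2v fin.
have Lx k kN := (Lxu k kN).1; have Lu k kN := (Lxu k kN).2.
rewrite (Psi_decomposition api amu Lx Lu).
rewrite (Psi_decomposition api admissible_mu_star); last 2 first.
- by move=> k /(L2v_mu_star api)[].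
- by move=> k /(L2v_mu_star api)[].
apply: leeD2l.
have Le k : (k <= N)%N -> L2v P (e k).
  by move=> kN; apply: (L2v_err api amu); exact: leqW.
have Lh k : (k <= N)%N -> L2v P (xh k) by move=> kN; apply: L2vB; [exact: Lx|exact: Le].
have La k : (k <= N)%N -> L2v P (fun o => u k o + Lg k *m xh k o).
  by move=> kN; apply: L2vD; [exact: Lu|apply: L2vM; exact: Lh].
pose c1 k o := qf (G k) (e k o) + (dl k o)%:R * theta k.
pose c2 k o := qf (Lm k) (u k o + Lg k *m xh k o).
pose c3 k o := ((u k o + Lg k *m xh k o)^T *m (Lm k *m Lg k) *m e k o) 0 0.
have E1 k o : (k <= N)%N -> control_loss pis mus k o = c1 k o.
  move=> kN; rewrite (control_loss_mu_star pis o kN) /c1.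
  (* [c1] is written with the errors and triggers under [mu]; they coincide with those under [mus],
     so [c1] is common to both costs. *)
  have [He Hd] := @err_feedback_unique _ _ A _ _ rule _ _
    (dp_pi_star_err A B N Q Rc m0 theta P w mus (x0 o) (w^~ o))
    (dp_pi_star_err A B N Q Rc m0 theta P w mu (x0 o) (w^~ o)) k.
  exact: (f_equal2 (fun v (b : bool) => qf (G k) v + b%:R * theta k) He Hd).
have E2 k o : (k <= N)%N -> control_loss pis mu k o = c1 k o + c2 k o + 2 * c3 k o.
  move=> kN; rewrite /control_loss /c1 /c2 /c3.
  have -> : u k o + Lg k *m x k o = (u k o + Lg k *m xh k o) + Lg k *m e k o.
    by rewrite -addrA -mulmxDr subrK.
  rewrite qfD; last exact: (pd_Lam A B psdQ pdRc kN).1.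
  rewrite (qf_Gam A B psdQ pdRc)// !mulmxA.
  by ring.
have Ic1 k : (k <= N)%N -> P.-integrable setT (fun o => (c1 k o)%:E).
  move=> kN; rewrite /c1; apply: integrable_finD; last exact: (integrable_dp_theta api amu).
  exact: integrable_qf (Le k kN).
have Ic2 k : (k <= N)%N -> P.-integrable setT (fun o => (c2 k o)%:E).
  by move=> kN; exact: integrable_qf (La k kN).
have Ic3 k : (k <= N)%N -> P.-integrable setT (fun o => (c3 k o)%:E).
  by move=> kN; exact: integrable_bilinear (La k kN) (Le k kN).
have kN (k : 'I_N.+1) : (k <= N)%N := ltn_ord k.
have L1 : (\int[P]_o (\sum_(k < N.+1) control_loss pis mus k o)%:E =
    \int[P]_o (\sum_(k < N.+1) c1 k o)%:E)%E.
  apply: eq_integral => o _; apply: (f_equal EFin).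
  by apply: eq_bigr => k _; exact: (E1 k o (kN k)).
have L2 : (\int[P]_o (\sum_(k < N.+1) control_loss pis mu k o)%:E =
    \int[P]_o (\sum_(k < N.+1) c1 k o + \sum_(k < N.+1) c2 k o
      + \sum_(k < N.+1) 2 * c3 k o)%:E)%E.
  apply: eq_integral => o _; apply: (f_equal EFin); rewrite -!big_split /=.
  by apply: eq_bigr => k _; exact: (E2 k o (kN k)).
rewrite [leLHS]L1 [leRHS]L2 {L1 L2}.
have IS1 : P.-integrable setT (fun o => (\sum_(k < N.+1) c1 k o)%:E).
  by apply: integrable_fin_sum => k; exact: Ic1.
have IS2 : P.-integrable setT (fun o => (\sum_(k < N.+1) c2 k o)%:E).
  by apply: integrable_fin_sum => k; exact: Ic2.
have I3 (k : 'I_N.+1) : P.-integrable setT (fun o => (2 * c3 k o)%:E).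
  by apply: integrable_finZ; exact: Ic3.
have Z : (\int[P]_o (\sum_(k < N.+1) 2 * c3 k o)%:E = 0)%E.
  apply: integral_fin_sum0 => // k; under eq_integral do rewrite EFinM.
  rewrite integralZl//; last exact: Ic3.
  by rewrite control_error_orthogonal ?mule0//; exact: Ic3.
rewrite integral_finD; [|exact: integrable_finD|exact: integrable_fin_sum].
rewrite Z adde0 integral_finD// leeDl//.
apply: integral_ge0 => o _; rewrite lee_fin; apply: sumr_ge0 => k _.
exact: (psd_Lam A B psdQ pdRc).
Qed.

End control.

End Game.

Theorem theorem2 (R : realType) (n m N : nat)
  (A : nat -> 'M[R]_n) (B : nat -> 'M[R]_(n, m))
  (Q : nat -> 'M[R]_n) (Rc : nat -> 'M[R]_m) (theta : nat -> R)
  (m0 : 'cV[R]_n) (M0 : 'M[R]_n) (W : nat -> 'M[R]_n)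
  (d : measure_display) (Omega : measurableType d) (P : probability Omega R)
  (x0 : Omega -> 'cV[R]_n) (w : nat -> Omega -> 'cV[R]_n) :
  (forall k, (k <= N)%N -> controllable (A k) (B k)) ->
  (forall k, (k <= N.+1)%N -> psd (Q k)) ->
  (forall k, (k <= N)%N -> pd (Rc k)) ->
  (forall k, (k <= N)%N -> 0 <= theta k) ->
  psd M0 ->
  (forall k, (k <= N)%N -> pd (W k)) ->
  rvec_measurable x0 ->
  (forall k, (k <= N)%N -> rvec_measurable (w k)) ->
  gaussian_vec P x0 m0 M0 ->
  (forall k, (k <= N)%N -> gaussian_vec P (w k) 0 (W k)) ->
  mutually_independent P
    (fun j : 'I_N.+2 => if val j is j'.+1 then w j' else x0) ->
  let pis := pi_star N A B Q Rc theta m0 P w in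
  let mus := mu_star N A B Q Rc m0 in
  [/\ admissible_trig N pis,
      admissible_ctrl N mus,
      (forall pi, admissible_trig N pi ->
         (Psi N A B Q Rc theta P w x0 pis mus <= Psi N A B Q Rc theta P w x0 pi mus)%E),
      (forall mu, admissible_ctrl N mu ->
         (Psi N A B Q Rc theta P w x0 pis mus <= Psi N A B Q Rc theta P w x0 pis mu)%E)
    & (forall k, (k <= N)%N -> forall e : 'cV[R]_n,
         VoI N A B Q Rc theta P w k (- e) = VoI N A B Q Rc theta P w k e)].
Proof.
move=> _ psdQ pdRc theta0 _ _ mx0 mw gx0 gw ind pis mus.
have {}mx0 : mvec x0 by apply/mvec_vtup.
have {}mw k : (k <= N)%N -> mvec (w k) by move=> kN; apply/mvec_vtup; exact: mw.
(* The Gaussian lemmas speak of the centred vector, and the noise has mean 0. *)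
have w0 k : w k = (fun o => w k o - 0) by apply/funext => o; rewrite subr0.
have L2e0 := gaussian_L2v mx0 gx0.
have syme0 := gaussian_symmetric mx0 gx0.
have L2w k : (k <= N)%N -> L2v P (w k).
  by move=> kN; rewrite w0; exact: gaussian_L2v (mw k kN) (gw k kN).
have symw k : (k <= N)%N -> symmetric_law P (w k).
  by move=> kN; rewrite w0; exact: gaussian_symmetric (mw k kN) (gw k kN).
split.
- exact: admissible_pi_star.
- exact: admissible_mu_star.
- by move=> pi api; exact: trigger_optimal.
- by move=> mu amu; exact: control_optimal.
- by move=> k kN e; exact: VoI_even.
Qed.
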